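(* Let $k\ge1$, fix $(\gamma_0,\gamma_1)\in\Gamma^k_{\mathrm{sup}}$ and let $r$ be the unique simple root of $\Delta_k$ in $\mathcal{S}=[\gamma_1,1-\gamma_0]$. Then, for any $\delta>0$ and any initial state $x=x_n\in\mathcal{S}^n$, we have $\mathbb{E}_x[T^n_{\mathrm{enter}}(B_\delta(r))]=O(\log n)$. Furthermore, the mixing time of the process $X^n$ satisfies $t^n_{\mathrm{mix}}=O(\log n)$.
   Context: Fix an integer $k\ge1$ (independent of $n$) and parameters $(\gamma_0,\gamma_1)\in\Gamma:=\{(\gamma_0,\gamma_1)\in(0,1)^2: 0<\gamma_0+\gamma_1<1\}$. Write $\mathcal{S}=[\gamma_1,1-\gamma_0]$ and let $P_k$ be the polynomial $P_k(x)=\sum_{r=k+1}^{2k}\binom{2k}{r}x^r(1-x)^{2k-r}$. The $2k$-choices model with stubborn agents: there are $n$ agents (complete network), with $N_i^n=\lceil n\gamma_i\rceil$ agents stubbornly holding opinion $i\in\{0,1\}$ forever; each other agent updates at the points of an independent unit-rate Poisson process by sampling $2k$ of the other $n-1$ agents uniformly at random with replacement and adopting the majority opinion among the sampled agents and itself. $X^n(t)$ is the proportion of agents holding opinion $1$ at time $t\ge0$. Equivalently (for $n$ large enough that the state space is nonempty), $X^n$ is the continuous-time birth-death Markov chain on $\mathcal{S}^n=\{N_1^n/n,(N_1^n+1)/n,\ldots,1-N_0^n/n\}$ jumping from $x$ to $x+1/n$ at rate $q^n_+(x)=n\left(1-x-\frac{N_0^n}{n}\right)P_k(b_nx)$ and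 from $x$ to $x-1/n$ at rate $q^n_-(x)=n\left(x-\frac{N_1^n}{n}\right)P_k(b_n(1-x))$, where $b_n=n/(n-1)$. It is ergodic with unique stationary distribution $\pi^n$. The limiting drift is the polynomial $\Delta_k(x)=(1-x-\gamma_0)P_k(x)-(x-\gamma_1)P_k(1-x)$. $\Gamma^k_{\mathrm{sup}}$ is the set of $(\gamma_0,\gamma_1)\in\Gamma$ for which $\Delta_k$ has exactly one real root (with multiplicity one) in $\mathcal{S}$. Notation: $B_\delta(p)=(p-\delta,p+\delta)$; $T^n_{\mathrm{enter}}(B)=\inf\{t\ge0:X^n(t)\in B\}$; $\mathbb{P}_x,\mathbb{E}_x$ denote probability and expectation given $X^n(0)=x\in\mathcal{S}^n$. $d^n(t)=\max_{x\in\mathcal{S}^n}\max_{A\subseteq\mathcal{S}^n}|\mathbb{P}_x(X^n(t)\in A)-\pi^n(A)|$ and $t^n_{\mathrm{mix}}=\inf\{t:d^n(t)\le1/4\}$. $f(n)=O(g(n))$ means $\limsup_{n\to\infty}f(n)/g(n)<\infty$. *)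

(* Defs.v *)
From HB Require Import structures.
From mathcomp Require Import all_boot all_order all_algebra.
From mathcomp Require Import all_classical all_reals all_analysis.

Set Implicit Arguments.
Unset Strict Implicit.
Unset Printing Implicit Defensive.

Import Order.TTheory GRing.Theory Num.Theory.
Import numFieldNormedType.Exports.

Local Open Scope classical_set_scope.
Local Open Scope ring_scope.

(* f(n) = O(g(n)) in the sense limsup f(n)/g(n) < oo, for an f that may take
   infinite values at some n. *)
Definition is_bigO (R : realType) (f : nat -> \bar R) (g : nat -> R) : Prop :=
  (limn_esup (fun n => f n * ((g n)^-1)%:E) < +oo)%E.

Section Markov.
Variables (R : realType) (m : nat).
Implicit Types (Q : 'M[R]_m.+1).

Definition generator (q : 'I_m.+1 -> 'I_m.+1 -> R) : 'M[R]_m.+1 :=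
  \matrix_(i, j) (if i == j then - \sum_(l | l != i) q i l else q i j).

(* exp(t Q), entrywise sum of the exponential series *)
Definition transition Q (t : R) : 'M[R]_m.+1 :=
  \matrix_(i, j)
    limn (series (fun l : nat => ((t ^+ l / l`!%:R) *: Q ^+ l) i j)).

(* (Pr x)_x are the laws, indexed by the initial state x, of a continuous-time
   Markov chain (X t)_(t >= 0) with generator Q. Only times t >= 0 matter.
   The Markov property is conditioned on arbitrary finite histories
   {X s = l for all (s, l) in h} before time t, and is written without division
   so that conditioning events of probability 0 need no convention. *)
Record markov_chain (d : measure_display) (T : measurableType d)
    (Q : 'M[R]_m.+1) (X : R -> T -> 'I_m.+1)
    (Pr : 'I_m.+1 -> probability T R) : Prop := MarkovChain {
  mc_measurable : forall t i, 0 <= t -> measurable (X t @^-1` [set i]);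
  mc_right_continuous : forall w t, 0 <= t ->
    \forall s \near t^'+, X s w = X t w;
  mc_initial : forall x, Pr x (X 0 @^-1` [set x]) = 1%E;
  mc_markov : forall (x : 'I_m.+1) (h : seq (R * 'I_m.+1)) (t u : R)
      (i j : 'I_m.+1),
    0 <= t -> 0 <= u -> {in h, forall p, 0 <= p.1 <= t} ->
    let past := [set w | {in h, forall p, X p.1 w = p.2}] in
    Pr x (past `&` X t @^-1` [set i] `&` X (t + u) @^-1` [set j]) =
    (Pr x (past `&` X t @^-1` [set i]) * (transition Q u i j)%:E)%E
}.

Definition stationary Q (p : 'rV[R]_m.+1) : Prop :=
  [/\ forall i, 0 <= p 0 i, \sum_i p 0 i = 1
    & forall t, 0 <= t -> p *m transition Q t = p].

(* max over initial states and sets A of |P_x(X(t) in A) - p(A)| *)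
Definition mixing_distance (d : measure_display) (T : measurableType d)
    (X : R -> T -> 'I_m.+1) (Pr : 'I_m.+1 -> probability T R)
    (p : 'rV[R]_m.+1) (t : R) : R :=
  \big[Num.max/0]_(x : 'I_m.+1) \big[Num.max/0]_(A : {set 'I_m.+1})
    `| fine (Pr x [set w | X t w \in A]) - \sum_(i in A) p 0 i |.

(* Extended-real infima, here and in [enter_time]: inf of the empty set is +oo. *)
Definition mixing_time (d : measure_display) (T : measurableType d)
    (X : R -> T -> 'I_m.+1) (Pr : 'I_m.+1 -> probability T R)
    (p : 'rV[R]_m.+1) : \bar R :=
  ereal_inf [set t%:E | t in
    [set t : R | 0 <= t /\ mixing_distance X Pr p t <= 1 / 4]].

End Markov.

Definition enter_time (R : realType) (T : Type) (Y : R -> T -> R) (B : set R)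
    (w : T) : \bar R :=
  ereal_inf [set t%:E | t in [set t : R | 0 <= t /\ B (Y t w)]].

Section Choices.
Variables (R : realType) (k : nat) (g0 g1 : R).

Definition majority_poly : {poly R} :=
  \sum_(k.+1 <= r < (2 * k).+1)
    ('C(2 * k, r))%:R *: ('X^r * (1 - 'X) ^+ (2 * k - r)).

Definition drift_poly : {poly R} :=
  ((1 - g0)%:P - 'X) * majority_poly
  - ('X - g1%:P) * (majority_poly \Po (1 - 'X)).

Definition in_Gamma : Prop :=
  [/\ 0 < g0 < 1, 0 < g1 < 1 & 0 < g0 + g1 < 1].

(* r is a simple root of the drift in [g1, 1 - g0], and the only root there *)
Definition unique_simple_root (r : R) : Prop :=
  [/\ r \in `[g1, 1 - g0], root drift_poly r, mup r drift_poly = 1%N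
    & forall s, s \in `[g1, 1 - g0] -> root drift_poly s -> s = r].

Definition in_Gamma_sup : Prop :=
  in_Gamma /\ exists r : R, unique_simple_root r.

Definition stubborn (g : R) (n : nat) : nat := `|Num.ceil (n%:R * g)|%N.

(* The index i < (top n).+1 stands for the state (N_1 + i) / n. When
   N_0 + N_1 <= n these are exactly the states N_1/n, ..., 1 - N_0/n; otherwise
   the state space of the model is empty and the truncated [top n] is junk. *)
Definition top (n : nat) : nat := (n - (stubborn g0 n + stubborn g1 n))%N.

Definition proportion (n : nat) (i : 'I_(top n).+1) : R :=
  (stubborn g1 n + i)%:R / n%:R.

Definition bfactor (n : nat) : R := n%:R / (n%:R - 1).

Definition up_rate (n : nat) (x : R) : R :=
  n%:R * (1 - x - (stubborn g0 n)%:R / n%:R) * majority_poly.[bfactor n * x].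

Definition down_rate (n : nat) (x : R) : R :=
  n%:R * (x - (stubborn g1 n)%:R / n%:R)
  * majority_poly.[bfactor n * (1 - x)].

Definition choices_generator (n : nat) : 'M[R]_((top n).+1) :=
  generator (fun i j : 'I_(top n).+1 =>
    if j == i.+1 :> nat then up_rate n (proportion i)
    else if i == j.+1 :> nat then down_rate n (proportion i)
    else 0).

End Choices.

(* Main.v *)
Require Import Defs.
From HB Require Import structures.
From mathcomp Require Import all_boot all_order all_algebra.
From mathcomp Require Import all_classical all_reals all_analysis.
From mathcomp Require Import measurable_realfun.
From mathcomp Require Import ring lra.

Set Implicit Arguments.
Unset Strict Implicit.
Unset Printing Implicit Defensive.

Import Order.TTheory GRing.Theory Num.Theory.
Import numFieldNormedType.Exports.

Local Open Scope classical_set_scope.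
Local Open Scope ring_scope.

(** Write Delta for the drift polynomial. It is positive at the left end g1 of
    [g1, 1 - g0] and negative at the right end, so its only root r there, being
    simple, gives Delta(x) = (r - x) h(x) with h bounded below by a constant
    a > 0 on the whole interval. Two consequences of this factorization carry
    the proof; both are inequalities for the generator L of the chain.

    Foster-Lyapunov bound. For V(x) = (x - r)^2 one has L V <= - 2 a V + O(1/n),
    hence E_x V(X_s) <= exp(- 2 a s) + O(1/n), and Chebyshev's inequality gives a
    time s, independent of n and of x, at which the chain is outside B_delta(r)
    with probability at most 1/2. By the Markov property the chain avoids
    B_delta(r) at the times s, 2s, ..., js with probability at most 2^-j, so the
    expected entrance time is at most 2s. This is even O(1).

    Contraction in a weighted Lipschitz norm. For a birth-death chain with birth
    rates lam and death rates mu, the discrete derivative of L F at the edge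
    (i, i+1) is a combination of the discrete derivatives of F at the
    neighbouring edges. If positive edge weights w satisfy
      lam_(i+1) w_(i+1) - (mu_(i+1) + lam_i) w_i + mu_i w_(i-1) <= - kappa w_i,
    then |F(i+1) - F(i)| <= w_i for all i implies the same for the function
    x |-> E_x F(X_t) with the bound multiplied by exp(- kappa t). In the limit of
    large n the condition reads (Delta w)' <= - kappa w. The weight w = 1/h turns
    Delta w into r - x, whose derivative is -1, so it satisfies the discrete
    condition for all large n with a constant kappa. As w is bounded above and
    away from 0 and there are at most n edges, two starting points give the same
    probability to any event up to O(n exp(- kappa t)), which is O(1/n) at
    t = (2 / kappa) ln n.

    Both bounds pass from the generator Q to exp(t Q) by uniformization:
    exp(q t) exp(t Q) = sum_l t^l / l! (Q + q)^l (lemma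
    [cvg_transition_shift]), where for q large Q + q has nonnegative entries, so
    that inequalities can be iterated power by power. *)

(** * Series and the exponential of a matrix *)

Lemma cauchy_product_series (R : realType) (a b : R^nat) n :
  series (fun l => \sum_(i < l.+1) a i * b (l - i)%N) n =
  \sum_(i < n) a i * series b (n - i)%N.
Proof.
elim: n => [|n IHn]; first by rewrite big_ord0 seriesEnat/= big_geq.
rewrite seriesSr IHn [in RHS]big_ord_recr /= subSnn big_ord_recr /= subnn.
rewrite addrA (_ : series b 1%N = b 0%N) ?seriesEnat /= ?big_nat1//.
rewrite -big_split /=; congr (_ + _).
by apply: eq_bigr => i _; rewrite subSn ?(ltnW (ltn_ord i))// big_nat_recr//= mulrDr.
Qed.

Lemma exp_coeffD (R : realType) (x y : R) l :
  exp_coeff (x + y) l = \sum_(i < l.+1) exp_coeff x i * exp_coeff y (l - i)%N.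
Proof.
rewrite /exp_coeff /= addrC exprDn mulr_suml; apply: eq_bigr => i _.
have il : (i <= l)%N by rewrite -ltnS.
have fn0 (j : nat) : (j`!%:R : R) != 0 by rewrite pnatr_eq0 -lt0n fact_gt0.
have /(congr1 (fun z : nat => z%:R : R)) := bin_fact il.
rewrite !natrM -mulr_natr => <-.
by rewrite [_ * _%:R]mulrC; field; rewrite !fn0 /= pnatr_eq0 -lt0n bin_gt0 il.
Qed.

Lemma cvg_series_dominated (R : realType) (a : R^nat) (x : R) :
  (forall l, `|a l| <= exp_coeff x l) -> cvgn (series a).
Proof.
move=> ax; apply: normed_cvg.
apply: (@series_le_cvg _ _ (exp_coeff x)) => //=.
- by move=> n; exact: le_trans (ax n).
- exact: is_cvg_series_exp_coeff.
Qed.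

(** Cauchy product of two series dominated by exponential series. The defect
    between the product of the partial sums and the partial sum of the Cauchy
    product is dominated by the same defect for the exponential series, which
    tends to 0 by [expRD]. *)
Lemma lim_cauchy_product (R : realType) (a b : R^nat) (x y : R) :
  (forall l, `|a l| <= exp_coeff x l) -> (forall l, `|b l| <= exp_coeff y l) ->
  series (fun l => \sum_(i < l.+1) a i * b (l - i)%N) n @[n --> \oo] -->
  limn (series a) * limn (series b).
Proof.
move=> ax by_.
have defect (u v : R^nat) n : series u n * series v n -
    series (fun l => \sum_(i < l.+1) u i * v (l - i)%N) n =
    \sum_(i < n) u i * \sum_(n - i <= j < n) v j.
  rewrite cauchy_product_series /series/= big_mkord mulr_suml -sumrB.
  apply: eq_bigr => i _; rewrite -mulrBr; congr (_ * _).
  by rewrite (@big_cat_nat _ _ _ (n - i)%N) ?leq_subr//= addrC addrK.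
pose D (u v : R^nat) n := series u n * series v n -
    series (fun l => \sum_(i < l.+1) u i * v (l - i)%N) n.
have Dexp : D (exp_coeff x) (exp_coeff y) n @[n --> \oo] --> 0.
  have -> : 0 = expR x * expR y - expR (x + y) by rewrite expRD subrr.
  apply: cvgB.
    by apply: cvgM; exact: is_cvg_series_exp_coeff.
  rewrite (_ : series _ = series (exp_coeff (x + y))).
    exact: is_cvg_series_exp_coeff.
  by congr series; apply/funext => l; rewrite -exp_coeffD.
have D0 : D a b n @[n --> \oo] --> 0.
  apply/norm_cvg0P.
  apply: (@squeeze_cvgr _ _ _ _ (fun=> 0) (D (exp_coeff x) (exp_coeff y))) => //;
    last exact: cvg_cst.
  apply: nearW => n; rewrite normr_ge0 /= /D !defect.
  apply: le_trans (ler_norm_sum _ _ _) _; apply: ler_sum => i _.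
  rewrite normrM ler_pM//.
  by apply: le_trans (ler_norm_sum _ _ _) _; apply: ler_sum => j _.
rewrite -[_ * _]subr0.
have -> : series (fun l => \sum_(i < l.+1) a i * b (l - i)%N) =
    (series a \* series b) \- D a b.
  by apply/funext => n; rewrite /D /= opprB addrC subrK.
apply: cvgB => //; apply: cvgM.
- exact: cvg_series_dominated ax.
- exact: cvg_series_dominated by_.
Qed.

Lemma norm_powmx_le (R : realType) (m : nat) (Q : 'M[R]_m.+1) l i j :
  `|(Q ^+ l) i j| <= (\sum_a \sum_b `|Q a b|) ^+ l.
Proof.
elim: l i j => [|l IHl] i j.
  by rewrite !expr0 mxE; case: eqP => _; rewrite ?normr1// normr0.
rewrite !exprS -mulmxE mxE; apply: le_trans (ler_norm_sum _ _ _) _.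
apply: (@le_trans _ _ (\sum_b `|Q i b| * (\sum_a \sum_b `|Q a b|) ^+ l)).
  by apply: ler_sum => b _; rewrite normrM ler_wpM2l.
rewrite -mulr_suml ler_wpM2r//.
  by rewrite exprn_ge0// sumr_ge0// => a _; rewrite sumr_ge0.
rewrite [leRHS](bigD1 i)//= lerDl sumr_ge0// => a _.
by rewrite sumr_ge0.
Qed.

Lemma norm_transition_term_le (R : realType) (m : nat) (Q : 'M[R]_m.+1) t l i j :
  `|((t ^+ l / l`!%:R) *: Q ^+ l) i j| <=
  exp_coeff (`|t| * \sum_a \sum_b `|Q a b|) l.
Proof.
rewrite mxE normrM normf_div normrX (ger0_norm (ler0n _ _)) /exp_coeff /=.
by rewrite exprMn mulrAC ler_wpM2r// ler_wpM2l ?exprn_ge0// norm_powmx_le.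
Qed.

(** Uniformization: exp(q t) exp(t Q) = exp(t (Q + q)), entrywise. *)
Lemma cvg_transition_shift (R : realType) (m : nat) (Q : 'M[R]_m.+1) (q t : R)
    (i j : 'I_m.+1) :
  series (fun l => t ^+ l / l`!%:R * ((Q + q%:M) ^+ l) i j) n @[n --> \oo] -->
  expR (q * t) * transition Q t i j.
Proof.
rewrite [transition _ _ _ _]mxE.
pose b l := ((t ^+ l / l`!%:R) *: Q ^+ l) i j.
have qt l : `|exp_coeff (q * t) l| <= exp_coeff `|q * t| l.
  by rewrite /exp_coeff /= normf_div normrX (ger0_norm (ler0n _ _)).
suff -> : (fun l => t ^+ l / l`!%:R * ((Q + q%:M) ^+ l) i j) =
    (fun l => \sum_(s < l.+1) exp_coeff (q * t) s * b (l - s)%N).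
  exact: (lim_cauchy_product qt (fun l => norm_transition_term_le Q t l i j)).
apply/funext => l.
have comm : GRing.comm Q q%:M by exact: scalar_mxC.
rewrite (exprDn_comm _ comm) summxE mulr_sumr; apply: eq_bigr => s _.
have sl : (s <= l)%N by rewrite -ltnS.
have fn0 (z : nat) : (z`!%:R : R) != 0 by rewrite pnatr_eq0 -lt0n fact_gt0.
have /(congr1 (fun z : nat => z%:R : R)) := bin_fact sl.
rewrite !natrM /exp_coeff /= => <-.
rewrite -rmorphXn /= -mulmxE mul_mx_scalar mulmxnE [in RHS]/b !mxE.
rewrite -[in t ^+ l](subnKC sl) exprD exprMn -mulr_natr.
by field; rewrite !fn0 /= pnatr_eq0 -lt0n bin_gt0 sl.
Qed.

(** * Birth-death chains *)

(** States are 0, ..., m, but rates and functions on the states are indexed by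
    nat; thanks to [mu0] and [lam_top] their values outside 0, ..., m do not
    matter. *)
Section BirthDeath.
Variables (R : realType) (m : nat) (lam mu : nat -> R).
Implicit Types (F G w : nat -> R) (q c kappa t : R).

(** The generator with birth rates lam and death rates mu. *)
Definition bd_generator : 'M[R]_m.+1 :=
  generator (fun i j : 'I_m.+1 =>
    if j == i.+1 :> nat then lam i else if i == j.+1 :> nat then mu i else 0).

(** The action of the generator on functions. At i = 0 the term with i.-1 = 0
    vanishes. *)
Definition bd_op F : nat -> R :=
  fun i => lam i * (F i.+1 - F i) + mu i * (F i.-1 - F i).

(** The function x |-> E_x F(X_t). *)
Definition bd_semigroup t F (i : 'I_m.+1) : R :=
  \sum_(j < m.+1) transition bd_generator t i j * F j.

Hypotheses (mu0 : mu 0 = 0) (lam_top : lam m = 0).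
Hypotheses (lam_ge0 : forall i, (i <= m)%N -> 0 <= lam i)
           (mu_ge0 : forall i, (i <= m)%N -> 0 <= mu i).

Lemma bd_generator_mul F (i : 'I_m.+1) :
  \sum_(j < m.+1) bd_generator i j * F j = bd_op F i.
Proof.
pose q (j : 'I_m.+1) : R :=
  if j == i.+1 :> nat then lam i else if i == j.+1 :> nat then mu i else 0.
have -> : \sum_(j < m.+1) bd_generator i j * F j =
    \sum_(j < m.+1) q j * (F j - F i).
  rewrite (bigD1 i)//= [RHS](bigD1 i)//= subrr mulr0 add0r.
  rewrite mxE eqxx mulNr addrC mulr_suml -sumrB.
  apply: eq_bigr => j ji; rewrite mxE eq_sym (negbTE ji).
  by rewrite mulrBr.
have -> : \sum_(j < m.+1) q j * (F j - F i) =
    \sum_(j < m.+1 | j == i.+1 :> nat) lam i * (F j - F i) +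
    \sum_(j < m.+1 | j == i.-1 :> nat) mu i * (F j - F i).
  rewrite [X in X + _]big_mkcond [X in _ + X]big_mkcond -big_split /=.
  apply: eq_bigr => j _; rewrite /q.
  case: ifP => [/eqP ->|_].
    by rewrite (_ : (i.+1 == i.-1) = false) ?addr0// gtn_eqF// ltnS leq_pred.
  case: ifP => [/eqP ->|ij]; first by rewrite /= eqxx add0r.
  rewrite mul0r add0r; case: ifP => // /eqP ji.
  have i0 : i = 0%N :> nat.
    by case: (nat_of_ord i) ij ji => // z /eqP + /= jz; rewrite jz.
  by rewrite i0 mu0 mul0r.
have ltSm (z : 'I_m.+1) : (z <= m)%N by rewrite -ltnS.
rewrite (big_ord1_eq _ (fun j => lam i * (F j - F i)))
        (big_ord1_eq _ (fun j => mu i * (F j - F i))).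
rewrite (leq_ltn_trans (leq_pred i) (ltn_ord i)) /bd_op ltnS.
case: ltnP => // mi; have -> : i = m :> nat by apply/eqP; rewrite eqn_leq ltSm mi.
by rewrite lam_top mul0r.
Qed.

(** The uniformized operator q + L. *)
Definition bd_step q F : nat -> R := fun i => q * F i + bd_op F i.

Lemma bd_generator_shift_pow q F l (i : 'I_m.+1) :
  \sum_(j < m.+1) ((bd_generator + q%:M) ^+ l) i j * F j =
  iter l (bd_step q) F i.
Proof.
elim: l i => [|l IHl] i /=.
  rewrite expr0 (bigD1 i)//= mxE eqxx mul1r big1 ?addr0// => j ji.
  by rewrite mxE eq_sym (negbTE ji) mul0r.
rewrite exprS -mulmxE; under eq_bigr do rewrite mxE mulr_suml.
rewrite exchange_big /=.
under eq_bigr => s _.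
  under eq_bigr do rewrite -mulrA.
  rewrite -mulr_sumr IHl; over.
under eq_bigr do rewrite mxE mulrDl.
rewrite big_split /= bd_generator_mul /bd_step addrC; congr (_ + _).
rewrite (bigD1 i)//= mxE eqxx big1 ?addr0// => j ji.
by rewrite mxE eq_sym (negbTE ji) mul0r.
Qed.

Lemma cvg_bd_semigroup q t F (i : 'I_m.+1) :
  series (fun l => t ^+ l / l`!%:R * iter l (bd_step q) F i) n @[n --> \oo] -->
  expR (q * t) * bd_semigroup t F i.
Proof.
rewrite /bd_semigroup mulr_sumr.
have -> : series (fun l => t ^+ l / l`!%:R * iter l (bd_step q) F i) =
    (fun n => \sum_(j < m.+1) series (fun l => t ^+ l / l`!%:R *
       ((bd_generator + q%:M) ^+ l) i j) n * F j).
  apply/funext => n; rewrite /series /=.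
  under [RHS]eq_bigr do rewrite mulr_suml.
  rewrite exchange_big /=; apply: eq_bigr => l _.
  rewrite -bd_generator_shift_pow mulr_sumr.
  by apply: eq_bigr => j _; rewrite mulrA.
apply: cvg_big => [|j _]; first exact: add_continuous.
rewrite mulrA; apply: cvgMr_tmp.
exact: cvg_transition_shift.
Qed.

Lemma iter_bd_step_le q c F l i :
  (forall i, (i <= m)%N -> lam i + mu i <= q) -> 0 <= q - c ->
  (forall i, (i <= m)%N -> bd_op F i <= - c * F i) -> (i <= m)%N ->
  iter l (bd_step q) F i <= (q - c) ^+ l * F i.
Proof.
move=> rates_q qc FL; elim: l i => [|l IHl] i im; first by rewrite expr0 mul1r.
set G := iter l _ _ in IHl *.
have -> : iter l.+1 (bd_step q) F i =
    (q - lam i - mu i) * G i + lam i * G i.+1 + mu i * G i.-1.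
  by rewrite /= -/G /bd_step /bd_op; ring.
have lamG : lam i * G i.+1 <= lam i * ((q - c) ^+ l * F i.+1).
  move: im; rewrite leq_eqVlt => /orP[/eqP ->|im]; first by rewrite lam_top !mul0r.
  by rewrite ler_wpM2l ?lam_ge0 ?(ltnW im)// IHl.
have muG : mu i * G i.-1 <= mu i * ((q - c) ^+ l * F i.-1).
  by rewrite ler_wpM2l ?mu_ge0// IHl// (leq_trans (leq_pred _)).
have G0 : (q - lam i - mu i) * G i <= (q - lam i - mu i) * ((q - c) ^+ l * F i).
  by rewrite ler_wpM2l ?IHl//; have := rates_q i im; lra.
have : (q - c) ^+ l * bd_op F i <= (q - c) ^+ l * (- c * F i).
  by rewrite ler_wpM2l ?exprn_ge0// FL.
rewrite exprS /bd_op; lra.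
Qed.

(** A uniformization constant, large enough for the two iteration lemmas. *)
Lemma bd_rate_bound c : exists q, [/\ 0 <= q - c,
  forall i, (i <= m)%N -> lam i + mu i <= q &
  forall i, (i < m)%N -> lam i + mu i.+1 <= q].
Proof.
exists (`|c| + (\sum_(i < m.+1) lam i + \sum_(i < m.+1) mu i)).
have lamS i : (i <= m)%N -> lam i <= \sum_(i < m.+1) lam i.
  move=> im; rewrite (bigD1 (Ordinal (im : i < m.+1)%N))//= lerDl sumr_ge0// => j _.
  by rewrite lam_ge0// -ltnS.
have muS i : (i <= m)%N -> mu i <= \sum_(i < m.+1) mu i.
  move=> im; rewrite (bigD1 (Ordinal (im : i < m.+1)%N))//= lerDl sumr_ge0// => j _.
  by rewrite mu_ge0// -ltnS.
have c0 : 0 <= `|c| by [].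
have cc := ler_norm c.
split=> [|i im|i im].
- have := lam_ge0 (leq0n m); have := mu_ge0 (leq0n m).
  have := lamS 0%N (leq0n m); have := muS 0%N (leq0n m); lra.
- have := lamS i im; have := muS i im; lra.
- have := lamS i (ltnW im); have := muS i.+1 im; lra.
Qed.

Lemma bd_semigroup_le c t F (i : 'I_m.+1) : 0 <= t ->
  (forall i, (i <= m)%N -> bd_op F i <= - c * F i) ->
  bd_semigroup t F i <= expR (- c * t) * F i.
Proof.
move=> t0 FL; have [q [qc rates_q _]] := bd_rate_bound c.
rewrite -(ler_pM2l (expR_gt0 (q * t))) mulrA -expRD -mulrDl.
have expcvg : series (exp_coeff ((q - c) * t)) n @[n --> \oo] -->
    expR ((q + - c) * t) by exact: is_cvg_series_exp_coeff.
apply: (ler_cvg_to (@cvg_bd_semigroup q t F i) (cvgMr_tmp expcvg)).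
apply: nearW => n; rewrite /series /= mulr_suml; apply: ler_sum => l _.
rewrite /exp_coeff /= [_ * t]mulrC exprMn [X in X * F i]mulrAC -[leRHS]mulrA.
rewrite ler_wpM2l ?divr_ge0 ?exprn_ge0//.
by apply: iter_bd_step_le => //; rewrite -ltnS.
Qed.

(** At i = 0 the condition on w reads w i.-1 = w 0, with the coefficient
    mu 0 = 0. *)
Lemma iter_bd_step_lipschitz q kappa w F l i : 0 <= q - kappa ->
  (forall i, (i < m)%N -> lam i + mu i.+1 <= q) ->
  (forall i, (i < m)%N ->
    lam i.+1 * w i.+1 - (mu i.+1 + lam i) * w i + mu i * w i.-1 <=
    - kappa * w i) ->
  (forall i, (i < m)%N -> `|F i.+1 - F i| <= w i) -> (i < m)%N ->
  `|iter l (bd_step q) F i.+1 - iter l (bd_step q) F i| <=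
  (q - kappa) ^+ l * w i.
Proof.
move=> qk rates_q w_super Fw; elim: l i => [|l IHl] i im.
  by rewrite expr0 mul1r Fw.
set G := iter l _ _ in IHl *; set a := (q - kappa) ^+ l in IHl *.
have -> : iter l.+1 (bd_step q) F i.+1 - iter l.+1 (bd_step q) F i =
    lam i.+1 * (G i.+2 - G i.+1) + (q - lam i - mu i.+1) * (G i.+1 - G i) +
    mu i * (G i - G i.-1).
  by rewrite /= -/G /bd_step /bd_op /=; ring.
have q0 : 0 <= q - lam i - mu i.+1 by have := rates_q i im; lra.
have a0 : 0 <= a by rewrite exprn_ge0.
have H1 : `|lam i.+1 * (G i.+2 - G i.+1)| <= a * (lam i.+1 * w i.+1).
  move: im; rewrite leq_eqVlt => /orP[/eqP ->|im].
    by rewrite lam_top !mul0r mulr0 normr0.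
  rewrite normrM ger0_norm ?lam_ge0 ?(ltnW im)// mulrCA.
  by rewrite ler_wpM2l ?lam_ge0 ?(ltnW im)// IHl.
have H2 : `|(q - lam i - mu i.+1) * (G i.+1 - G i)| <=
    a * ((q - lam i - mu i.+1) * w i).
  by rewrite normrM ger0_norm// mulrCA ler_wpM2l// IHl.
have H3 : `|mu i * (G i - G i.-1)| <= a * (mu i * w i.-1).
  case: i {H1 H2 q0 a0} im => [|i] im; first by rewrite mu0 !mul0r mulr0 normr0.
  rewrite normrM ger0_norm ?mu_ge0 ?(ltnW im)//= mulrCA.
  by rewrite ler_wpM2l ?mu_ge0 ?(ltnW im)// IHl// ltnW.
rewrite exprS -/a; apply: le_trans (ler_normD _ _) _.
apply: le_trans (lerD (ler_normD _ _) (lexx _)) _.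
have := ler_wpM2l a0 (w_super i im); lra.
Qed.

(** Edge weights that form a strict supersolution for the discrete derivative
    of the generator are contracted exponentially by the semigroup. *)
Lemma bd_semigroup_lipschitz kappa w t F (i j : 'I_m.+1) : 0 <= t ->
  (forall i, (i < m)%N ->
    lam i.+1 * w i.+1 - (mu i.+1 + lam i) * w i + mu i * w i.-1 <=
    - kappa * w i) ->
  (forall i, (i < m)%N -> `|F i.+1 - F i| <= w i) -> j = i.+1 :> nat ->
  `|bd_semigroup t F j - bd_semigroup t F i| <= expR (- kappa * t) * w i.
Proof.
move=> t0 w_super Fw ji; have [q [qk _ rates_q]] := bd_rate_bound kappa.
rewrite -(ler_pM2l (expR_gt0 (q * t))) mulrA -expRD -mulrDl.
rewrite -[X in X * `|_|](ger0_norm (expR_ge0 _)) -normrM mulrBr.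
have expcvg : series (exp_coeff ((q - kappa) * t)) n @[n --> \oo] -->
    expR ((q + - kappa) * t) by exact: is_cvg_series_exp_coeff.
apply: (ler_cvg_to (cvg_norm (cvgB (@cvg_bd_semigroup q t F j)
  (@cvg_bd_semigroup q t F i))) (cvgMr_tmp expcvg)).
apply: nearW => n; rewrite !fctE /series /= -sumrB mulr_suml.
apply: le_trans (ler_norm_sum _ _ _) _; apply: ler_sum => l _.
rewrite -mulrBr normrM ger0_norm ?divr_ge0 ?exprn_ge0//.
rewrite /exp_coeff /= [_ * t]mulrC exprMn [X in _ <= X * w i]mulrAC -[leRHS]mulrA.
rewrite ler_wpM2l ?divr_ge0 ?exprn_ge0// ji.
by apply: iter_bd_step_lipschitz => //; rewrite -ltnS -ji.
Qed.

Lemma bd_semigroup_cst1 t (i : 'I_m.+1) : 0 <= t ->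
  bd_semigroup t (fun=> 1) i = 1.
Proof.
move=> t0; apply/eqP; rewrite eq_le; apply/andP; split.
  have := @bd_semigroup_le 0 t (fun=> 1) i t0.
  rewrite oppr0 !mul0r expR0 mul1r; apply=> z _.
  by rewrite /bd_op subrr !mulr0 addr0.
have := @bd_semigroup_le 0 t (fun=> - 1) i t0.
rewrite oppr0 !mul0r expR0 mul1r => H.
rewrite -lerN2; apply: le_trans (H _).
  by rewrite /bd_semigroup -sumrN; under [leRHS]eq_bigr do rewrite mulrN.
by move=> z _; rewrite /bd_op subrr !mulr0 addr0.
Qed.

(** The exponential estimate that follows from a Foster-Lyapunov inequality. *)
Lemma bd_semigroup_drift c b t V (i : 'I_m.+1) : 0 <= t -> 0 < c ->
  (forall i, (i <= m)%N -> bd_op V i <= - c * V i + b) ->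
  bd_semigroup t V i <= expR (- c * t) * (V i - b / c) + b / c.
Proof.
move=> t0 c0 LV; rewrite -lerBlDr.
apply: le_trans (@bd_semigroup_le c t (fun i => V i - b / c) i t0 _).
  rewrite /bd_semigroup; under [leRHS]eq_bigr do rewrite mulrBr.
  rewrite sumrB lerD2l lerN2 -mulr_suml.
  have := bd_semigroup_cst1 i t0; rewrite /bd_semigroup.
  by under eq_bigr do rewrite mulr1; move=> ->; rewrite mul1r.
move=> z zm /=.
have -> : - c * (V z - b / c) = - c * V z + b by field; rewrite gt_eqF.
by apply: le_trans (LV z zm); rewrite /bd_op le_eqVlt; apply/orP; left; apply/eqP; ring.
Qed.

Lemma bd_semigroup_contract kappa W w t F (i j : 'I_m.+1) : 0 <= t ->
  (forall i, (i < m)%N ->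
    lam i.+1 * w i.+1 - (mu i.+1 + lam i) * w i + mu i * w i.-1 <=
    - kappa * w i) ->
  (forall i, (i < m)%N -> `|F i.+1 - F i| <= w i) ->
  (forall i, (i < m)%N -> w i <= W) ->
  `|bd_semigroup t F i - bd_semigroup t F j| <= expR (- kappa * t) * (m%:R * W).
Proof.
move=> t0 w_super Fw wW.
have W0 : (0 < m)%N -> 0 <= W.
  by move=> m0; rewrite (le_trans _ (wW _ m0))// (le_trans _ (Fw _ m0)).
wlog ij : i j / (i <= j)%N.
  by move=> H; case: (leqP i j) => [|/ltnW] /H//; rewrite distrC.
pose f l := bd_semigroup t F (inord l : 'I_m.+1).
have fE (z : 'I_m.+1) : bd_semigroup t F z = f z by rewrite /f inord_val.
rewrite !fE distrC -telescope_sumr// (le_trans (ler_norm_sum _ _ _))//.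
apply: (@le_trans _ _ (\sum_(i <= l < j) expR (- kappa * t) * W)).
  apply: ler_sum_nat => l /andP[il lj].
  have lm : (l < m)%N by rewrite (leq_trans lj)// -ltnS.
  apply: le_trans (@bd_semigroup_lipschitz kappa w t F _ _ _ _ _ _) _ => //.
    by rewrite !inordK// ltnS// ltnW.
  by rewrite inordK ?ler_wpM2l ?expR_ge0 ?wW// ltnS ltnW.
rewrite sumr_const_nat -[leLHS]mulr_natl mulrCA ler_wpM2l ?expR_ge0//.
case: (posnP m) => [m0|/W0 W0']; last first.
  by rewrite ler_wpM2r// ler_nat (leq_trans (leq_subr _ _))// -ltnS.
have j0 : j = 0%N :> nat by apply/eqP; rewrite -leqn0 -m0 -ltnS.
by rewrite j0 sub0n m0 !mul0r.
Qed.

End BirthDeath.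

(** * Markov chains: laws, mixing distance, entrance times *)

(** No measurability is needed: the integral of a nonnegative function is the
    supremum of the integrals of the simple functions below it. *)
Lemma ge0_le_integralT (d : measure_display) (T : measurableType d)
    (R : realType) (mu : {measure set T -> \bar R}) (f g : T -> \bar R) :
  (forall w, (0 <= f w)%E) -> (forall w, (f w <= g w)%E) ->
  (\int[mu]_(w in [set: T]) f w <= \int[mu]_(w in [set: T]) g w)%E.
Proof.
move=> f0 fg; have g0 w : (0 <= g w)%E by exact: le_trans (fg w).
rewrite !ge0_integralTE//; apply: ereal_sup_le => _ [h /= hf <-].
by exists h => // w; exact: le_trans (fg w).
Qed.

Section MarkovChain.
Variables (R : realType) (m : nat) (d : measure_display) (T : measurableType d).
Variables (Q : 'M[R]_m.+1) (X : R -> T -> 'I_m.+1).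
Variable (Pr : 'I_m.+1 -> probability T R).
Hypothesis mcX : markov_chain Q X Pr.

Lemma state_setI_bigsetU (E : set T) (t : R) (A : {set 'I_m.+1}) :
  E `&` [set w | X t w \in A] =
  \big[setU/set0]_(j in A) (E `&` X t @^-1` [set j]).
Proof.
rewrite -(bigcup_pred (mem A)); apply/seteqP; split => w /=.
  by move=> [Ew Aw]; exists (X t w).
by move=> [j /= jA [Ew ->]].
Qed.

Lemma measurable_state (t : R) (A : {set 'I_m.+1}) : 0 <= t ->
  measurable [set w | X t w \in A].
Proof.
move=> t0; rewrite -[X in measurable X]setTI state_setI_bigsetU.
apply: bigsetU_measurable => j _; rewrite setTI.
exact: (mc_measurable mcX).
Qed.

Lemma probability_state_setI (x : 'I_m.+1) (E : set T) (t : R)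
    (A : {set 'I_m.+1}) : 0 <= t -> measurable E ->
  Pr x (E `&` [set w | X t w \in A]) =
  (\sum_(j in A) Pr x (E `&` X t @^-1` [set j]))%E.
Proof.
move=> t0 mE; rewrite state_setI_bigsetU measure_bigsetU_ord//.
- by move=> j; apply: measurableI => //; exact: (mc_measurable mcX).
- by move=> i j _ _ [w [[_ <-] [_ <-]]].
Qed.

Lemma past_nil : [set w | {in [::], forall p : R * 'I_m.+1, X p.1 w = p.2}] = setT.
Proof. by apply/seteqP; split=> // w _ p; rewrite in_nil. Qed.

Lemma measure_setI_initial (x : 'I_m.+1) (E : set T) : measurable E ->
  Pr x (X 0 @^-1` [set x] `&` E) = Pr x E.
Proof.
move=> mE; have m0 := mc_measurable mcX x (lexx 0).
rewrite [RHS](measureDI (Pr x) mE m0) setIC [X in (X + _)%E](_ : _ = 0%E) ?add0e//.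
apply/eqP; rewrite eq_le measure_ge0 andbT.
apply: (@le_trans _ _ (Pr x (~` (X 0 @^-1` [set x])))); last first.
  by rewrite probability_setC// (mc_initial mcX) subee.
apply: le_measure; rewrite ?inE//; first exact: measurableD.
exact: measurableC.
Qed.

Lemma probability_state (x j : 'I_m.+1) (u : R) : 0 <= u ->
  Pr x (X u @^-1` [set j]) = (transition Q u x j)%:E.
Proof.
move=> u0; have mu_ := mc_measurable mcX j u0.
have /(_ _)/= := @mc_markov _ _ _ _ _ _ _ mcX x [::] 0 u x j (lexx _) u0.
rewrite past_nil setTI (mc_initial mcX) mul1e add0r => <-//.
by rewrite measure_setI_initial.
Qed.

Lemma transition_ge0 (x j : 'I_m.+1) (u : R) : 0 <= u -> 0 <= transition Q u x j.
Proof. by move=> u0; rewrite -lee_fin -probability_state. Qed.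

Lemma probability_state_in (x : 'I_m.+1) (u : R) (A : {set 'I_m.+1}) : 0 <= u ->
  Pr x [set w | X u w \in A] = (\sum_(j in A) transition Q u x j)%:E.
Proof.
move=> u0; rewrite -[X in Pr x X]setTI probability_state_setI// -sumEFin.
by apply: eq_bigr => j _; rewrite setTI probability_state.
Qed.

(** By stationarity, the distance to the stationary law is at most the largest
    distance between the laws started from two points. *)
Lemma mixing_distance_le (p : 'rV[R]_m.+1) (t e : R) : 0 <= t -> 0 <= e ->
  stationary Q p ->
  (forall (x y : 'I_m.+1) (A : {set 'I_m.+1}),
    `|\sum_(j in A) transition Q t x j - \sum_(j in A) transition Q t y j| <= e) ->
  mixing_distance X Pr p t <= e.
Proof.
move=> t0 e0 [p0 p1 pt] He; apply: bigmax_le => // x _; apply: bigmax_le => // A _.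
rewrite probability_state_in//=.
have -> : \sum_(i in A) p 0 i =
    \sum_y p 0 y * \sum_(i in A) transition Q t y i.
  rewrite -{1}(pt t t0); under eq_bigr do rewrite mxE.
  by rewrite exchange_big; apply: eq_bigr => y _; rewrite mulr_sumr.
rewrite -[X in X - _]mul1r -p1 mulr_suml -sumrB.
apply: le_trans (ler_norm_sum _ _ _) _.
rewrite -[leRHS]mul1r -p1 mulr_suml; apply: ler_sum => y _.
by rewrite -mulrBr normrM ger0_norm// ler_wpM2l.
Qed.

(** The event that the chain is in A at each of the times t + s, ..., t + j s. *)
Fixpoint stays (A : {set 'I_m.+1}) (s : R) (j : nat) (t : R) : set T :=
  if j is j'.+1 then [set w | X (t + s) w \in A] `&` stays A s j' (t + s)
  else setT.

Lemma measurable_stays A s j t : 0 <= s -> 0 <= t -> measurable (stays A s j t).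
Proof.
move=> s0; elim: j t => [|j IHj] t t0 //=; have ts := addr_ge0 t0 s0.
by apply: measurableI; [exact: measurable_state|exact: IHj].
Qed.

Lemma measurable_past (h : seq (R * 'I_m.+1)) : {in h, forall p, 0 <= p.1} ->
  measurable [set w | {in h, forall p, X p.1 w = p.2}].
Proof.
elim: h => [|p h IHh] h0.
  by rewrite past_nil.
rewrite (_ : [set _ | _] =
  X p.1 @^-1` [set p.2] `&` [set w | {in h, forall p, X p.1 w = p.2}]).
  apply: measurableI.
    by apply: (mc_measurable mcX); apply: h0; rewrite mem_head.
  by apply: IHh => a ah; apply: h0; rewrite inE ah orbT.
apply/seteqP; split=> w /=.
  move=> H; split; first by apply: H; rewrite mem_head.
  by move=> a ah; apply: H; rewrite inE ah orbT.
by move=> [Hp Hh] a; rewrite inE => /orP[/eqP ->|/Hh].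
Qed.

(** The induction on j needs an arbitrary past, because the Markov property
    conditions on the states visited at finitely many earlier times. *)
Lemma probability_stays_past (A : {set 'I_m.+1}) (s : R) j x
    (h : seq (R * 'I_m.+1)) (t : R) (i : 'I_m.+1) : 0 <= s -> 0 <= t ->
  (forall y, \sum_(l in A) transition Q s y l <= 1 / 2) ->
  {in h, forall p, 0 <= p.1 <= t} ->
  let past := [set w | {in h, forall p, X p.1 w = p.2}] in
  (Pr x (past `&` X t @^-1` [set i] `&` stays A s j t) <=
   ((1 / 2) ^+ j)%:E * Pr x (past `&` X t @^-1` [set i]))%E.
Proof.
move=> s0 + half; elim: j h t i => [|j IHj] h t i t0 ht /=;
    set past := [set w | _].
  by rewrite setIT expr0 mul1e.
have ts := addr_ge0 t0 s0.
pose h' := (t, i) :: h.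
have h't : {in h', forall p, 0 <= p.1 <= t}.
  by move=> p; rewrite inE => /orP[/eqP ->|/ht//]; rewrite /= t0 lexx.
have past'E : past `&` X t @^-1` [set i] =
    [set w | {in h', forall p, X p.1 w = p.2}].
  apply/seteqP; split=> w /=.
    by move=> [Hh Xt] p; rewrite inE => /orP[/eqP ->|/Hh].
  move=> H; split; last by apply: (H (t, i)); rewrite mem_head.
  by move=> a ah; apply: H; rewrite inE ah orbT.
have mpast' : measurable (past `&` X t @^-1` [set i]).
  by rewrite past'E; apply: measurable_past => p /h't/andP[].
rewrite setIA setIAC probability_state_setI//; last first.
  by apply: measurableI => //; exact: measurable_stays.
set a := Pr x (past `&` X t @^-1` [set i]).
apply: (@le_trans _ _ (\sum_(l in A)
    ((1 / 2) ^+ j)%:E * (a * (transition Q s i l)%:E))%E).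
  apply: lee_sum => l _; rewrite setIAC /a.
  rewrite -(@mc_markov _ _ _ _ _ _ _ mcX x h t s i l t0 s0 ht) past'E.
  apply: IHj => // p /h't /andP[-> /=] /le_trans; apply.
  by rewrite lerDl.
have afin : a \is a fin_num by exact: fin_num_measure.
rewrite -(fineK afin); under eq_bigr do rewrite -!EFinM.
rewrite sumEFin -EFinM lee_fin exprSr -mulr_sumr -mulrA ler_wpM2l ?exprn_ge0//.
rewrite -mulr_sumr mulrC ler_wpM2r ?half//.
by apply: fine_ge0; exact: measure_ge0.
Qed.

Lemma probability_stays (A : {set 'I_m.+1}) (s : R) j x : 0 <= s ->
  (forall y, \sum_(l in A) transition Q s y l <= 1 / 2) ->
  (Pr x (stays A s j 0) <= ((1 / 2) ^+ j)%:E)%E.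
Proof.
move=> s0 half;
have ms := measurable_stays A j s0 (lexx 0).
have := @probability_stays_past A s j x [::] 0 x s0 (lexx _) half.
rewrite /= past_nil !setTI (mc_initial mcX) mule1 => H; apply: le_trans (H _) => //.
by rewrite measure_setI_initial.
Qed.

(** If j is least such that the chain is not in A at all of s, ..., j s, then
    the entrance time is at most j s, and the first j terms of the series on the
    right are all equal to s. *)
Lemma enter_time_le (f : 'I_m.+1 -> R) (B : set R) (s : R) (w : T) :
  let A := [set i | ~~ `[< B (f i) >]]%SET in 0 < s ->
  (enter_time (fun t v => f (X t v)) B w <=
   \sum_(0 <= j <oo) (s * \1_(stays A s j 0) w)%:E)%E.
Proof.
move=> A s0; have term0 j : (0 <= (s * \1_(stays A s j 0) w)%:E)%E.
  by rewrite lee_fin mulr_ge0// ltW.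
have enter j t : 0 <= t -> ~ stays A s j t w ->
    exists i, (i < j)%N /\ B (f (X (t + s *+ i.+1) w)).
  elim: j t => [|j IHj] t t0 //= /not_andP[|].
    rewrite inE => /negP; rewrite negbK => /asboolP Bf.
    by exists 0%N; split.
  move=> /IHj[|i [ij Bi]]; first by rewrite addr_ge0// ltW.
  by exists i.+1; split=> //; rewrite mulrS addrA.
have sum_ge j : (forall l, (l < j)%N -> stays A s l 0 w) ->
    ((s *+ j)%:E <= \sum_(0 <= j <oo) (s * \1_(stays A s j 0) w)%:E)%E.
  move=> stay; apply: le_trans (nneseries_lim_ge j (fun n _ _ => term0 n)).
  rewrite sumEFin lee_fin big_mkord (eq_bigr (fun=> s)).
    by rewrite sumr_const card_ord.
  by move=> i _; rewrite indicE mem_set ?mulr1//; exact: stay.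
have [[j nj]|all] := pselect (exists j, ~ stays A s j 0 w); last first.
  suff -> : (\sum_(0 <= j <oo) (s * \1_(stays A s j 0) w)%:E = +oo)%E.
    by rewrite leey.
  apply/eqyP => M _; apply: le_trans (sum_ge `|Num.ceil (M / s)|%N _); last first.
    by move=> l _; apply: contrapT => nl; apply: all; exists l.
  rewrite lee_fin -mulr_natr mulrC -ler_pdivrMr//.
  by rewrite natr_absz (le_trans (ceil_ge _))// ler_int ler_norm.
have ex : exists j, `[< ~ stays A s j 0 w >] by exists j; apply/asboolP.
case: (ex_minnP ex) => {nj} {}j /asboolP nj jmin.
apply: le_trans (sum_ge j _); last first.
  move=> l lj; apply: contrapT => nl; move: lj; rewrite ltnNge jmin//.
  exact/asboolP.
have [i [ij Bi]] := enter j 0 (lexx 0) nj.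
apply: (@le_trans _ _ (0 + s *+ i.+1)%:E).
  apply: ereal_inf_lbound; exists (0 + s *+ i.+1) => //; split=> //.
  by rewrite add0r mulrn_wge0// ltW.
by rewrite add0r lee_fin ler_wpMn2l// ltW.
Qed.

Lemma expectation_enter_time_le (f : 'I_m.+1 -> R) (B : set R) (s : R)
    (x : 'I_m.+1) : 0 < s ->
  (forall y, \sum_(l in [set i | ~~ `[< B (f i) >]]%SET) transition Q s y l <=
    1 / 2) ->
  (\int[Pr x]_(w in [set: T]) enter_time (fun t v => f (X t v)) B w <=
   (2 * s)%:E)%E.
Proof.
move=> s0; set A := [set i | _]%SET => half; have s0' := ltW s0.
have term0 j w : (0 <= (s * \1_(stays A s j 0) w)%:E)%E.
  by rewrite lee_fin mulr_ge0.
apply: le_trans (@ge0_le_integralT _ _ _ _ _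
  (fun w => \sum_(0 <= j <oo) (s * \1_(stays A s j 0) w)%:E)%E _ _) _.
- by move=> w; apply: le_ereal_inf_tmp => _ [t [t0 _] <-]; rewrite lee_fin.
- by move=> w; exact: enter_time_le.
rewrite integral_nneseries//; last first.
  move=> j; apply/measurable_EFinP; apply: measurable_funM => //.
  by apply: measurable_indic; exact: measurable_stays.
apply: lime_le.
  by apply: is_cvg_nneseries => j _ _; exact: integral_ge0.
apply: nearW => n.
apply: (@le_trans _ _ (\sum_(0 <= j < n) (s * (1 / 2) ^+ j)%:E)%E).
  apply: lee_sum => j _; under eq_integral do rewrite EFinM.
  have ms := measurable_stays A j s0' (lexx 0).
  rewrite ge0_integralZl//; last first.
    by apply/measurable_EFinP; exact: measurable_indic.
  rewrite integral_indic// setIT EFinM lee_wpmul2l//.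
  exact: probability_stays.
rewrite sumEFin lee_fin.
have -> : \sum_(0 <= j < n) s * (1 / 2) ^+ j = 2 * s * (1 - (1 / 2) ^+ n).
  elim: n => [|n IHn]; first by rewrite big_geq// expr0 subrr mulr0.
  by rewrite big_nat_recr//= IHn exprS; field.
by rewrite ler_piMr ?mulr_ge0// gerBl exprn_ge0.
Qed.

End MarkovChain.

(** * Approximation up to O(1/n), uniformly in the state *)

Section UniformApproximation.
Variables (R : realType) (S : set R).
Implicit Types (u v e : nat -> R -> R).

(** The family u n x is bounded uniformly in n > 1 and x in S. *)
Definition unif_bounded u :=
  exists C, forall n x, (1 < n)%N -> S x -> `|u n x| <= C.

(** u n x = v n x + O(1/n), uniformly in x in S. *)
Definition unif_close u v :=
  exists C, forall n x, (1 < n)%N -> S x -> `|u n x - v n x| <= C / n%:R.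

Lemma inv_nat_le1 n : (1 < n)%N -> 0 <= (n%:R^-1 : R) <= 1.
Proof.
by move=> n1; rewrite invr_ge0 ler0n invf_le1 ?ltr0n ?ler1n ltnW.
Qed.

Lemma unif_bounded_eq u v : (forall n x, (1 < n)%N -> S x -> u n x = v n x) ->
  unif_bounded v -> unif_bounded u.
Proof. by move=> uv [C HC]; exists C => n x n1 Sx; rewrite uv ?HC. Qed.

Lemma unif_boundedC c : unif_bounded (fun _ _ => c).
Proof. by exists `|c|. Qed.

Lemma unif_boundedD u v : unif_bounded u -> unif_bounded v ->
  unif_bounded (fun n x => u n x + v n x).
Proof.
move=> [C HC] [D HD]; exists (C + D) => n x n1 Sx.
by rewrite (le_trans (ler_normD _ _))// lerD ?HC ?HD.
Qed.

Lemma unif_boundedN u : unif_bounded u -> unif_bounded (fun n x => - u n x).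
Proof. by move=> [C HC]; exists C => n x n1 Sx; rewrite normrN HC. Qed.

Lemma unif_boundedM u v : unif_bounded u -> unif_bounded v ->
  unif_bounded (fun n x => u n x * v n x).
Proof.
move=> [C HC] [D HD]; exists (C * D) => n x n1 Sx.
by rewrite normrM ler_pM ?HC ?HD.
Qed.

Lemma unif_bounded_horner (p : {poly R}) u : unif_bounded u ->
  unif_bounded (fun n x => p.[u n x]).
Proof.
move=> bu; elim/poly_ind: p => [|p c IHp].
  apply: (unif_bounded_eq _ (unif_boundedC 0)) => n x _ _; exact: horner0.
apply: (unif_bounded_eq _ (unif_boundedD (unif_boundedM IHp bu) (unif_boundedC c))).
by move=> n x _ _; rewrite hornerMXaddC.
Qed.

Lemma unif_close_bounded u v : unif_close u v -> unif_bounded v -> unif_bounded u.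
Proof.
move=> [C HC] [D HD]; exists (`|C| + D) => n x n1 Sx.
rewrite -[u n x](subrK (v n x)) (le_trans (ler_normD _ _))// lerD ?HD//.
apply: le_trans (HC _ _ n1 Sx) _; have /andP[n0 n1'] := inv_nat_le1 n1.
by rewrite (le_trans (ler_norm _))// normrM (ger0_norm n0) ler_piMr.
Qed.

Lemma unif_close_eq u v u' v' :
  (forall n x, (1 < n)%N -> S x -> u n x = u' n x) ->
  (forall n x, (1 < n)%N -> S x -> v n x = v' n x) ->
  unif_close u' v' -> unif_close u v.
Proof. by move=> uu vv [C HC]; exists C => n x n1 Sx; rewrite uu ?vv ?HC. Qed.

Lemma unif_close_refl u : unif_close u u.
Proof. by exists 0 => n x _ _; rewrite subrr normr0 mul0r. Qed.

Lemma unif_closeD u u' v v' : unif_close u u' -> unif_close v v' ->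
  unif_close (fun n x => u n x + v n x) (fun n x => u' n x + v' n x).
Proof.
move=> [C HC] [D HD]; exists (C + D) => n x n1 Sx.
rewrite opprD addrACA (le_trans (ler_normD _ _))// mulrDl lerD ?HC ?HD//.
Qed.

Lemma unif_closeN u u' : unif_close u u' ->
  unif_close (fun n x => - u n x) (fun n x => - u' n x).
Proof.
by move=> [C HC]; exists C => n x n1 Sx; rewrite -opprD normrN HC.
Qed.

Lemma unif_closeM u u' v v' : unif_close u u' -> unif_close v v' ->
  unif_bounded u' -> unif_bounded v' ->
  unif_close (fun n x => u n x * v n x) (fun n x => u' n x * v' n x).
Proof.
move=> cu [D HD] bu' [E HE]; have [B HB] := unif_close_bounded cu bu'.
have [C HC] := cu; exists (B * D + C * E) => n x n1 Sx.
have -> : u n x * v n x - u' n x * v' n x =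
    u n x * (v n x - v' n x) + (u n x - u' n x) * v' n x by ring.
have -> : (B * D + C * E) / n%:R = B * (D / n%:R) + C / n%:R * E by ring.
rewrite (le_trans (ler_normD _ _))//.
by rewrite !normrM lerD// ler_pM// ?HB ?HD ?HC ?HE.
Qed.

Lemma unif_close_invn u : unif_bounded u ->
  unif_close (fun n x => u n x / n%:R) (fun _ _ => 0).
Proof.
move=> [C HC]; exists C => n x n1 Sx; rewrite subr0 normrM.
have /andP[n0 _] := inv_nat_le1 n1.
by rewrite (ger0_norm n0) ler_wpM2r ?HC.
Qed.

Lemma unif_close_horner (p : {poly R}) u v : unif_close u v -> unif_bounded v ->
  unif_close (fun n x => p.[u n x]) (fun n x => p.[v n x]).
Proof.
move=> cuv bv; elim/poly_ind: p => [|p c IHp].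
  by apply: (unif_close_eq _ _ (unif_close_refl (fun _ _ => 0))) => n x _ _;
    exact: horner0.
apply: (unif_close_eq _ _ (unif_closeD
  (unif_closeM IHp cuv (unif_bounded_horner p bv) bv)
  (unif_close_refl (fun _ _ => c)))) => n x _ _; exact: hornerMXaddC.
Qed.

(** First-order Taylor expansion of a polynomial, along perturbed base points u
    and perturbed increments e / n. *)
Lemma unif_close_horner_diff (p : {poly R}) u v e f :
  unif_close u v -> unif_bounded v -> unif_close e f -> unif_bounded f ->
  unif_close (fun n x => n%:R * (p.[u n x + e n x / n%:R] - p.[u n x]))
    (fun n x => f n x * p^`().[v n x]).
Proof.
move=> cuv bv cef bf; elim/poly_ind: p => [|p c IHp].
  apply: (unif_close_eq _ _ (unif_close_refl (fun _ _ => 0))) => n x _ _.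
    by rewrite !horner0 subrr mulr0.
  by rewrite deriv0 horner0 mulr0.
have bpv := unif_bounded_horner p bv.
have bdpv := unif_bounded_horner p^`() bv.
have cue : unif_close (fun n x => u n x + e n x / n%:R) v.
  have be := unif_close_bounded cef bf.
  apply: (unif_close_eq _ _ (unif_closeD cuv (unif_close_invn be))) => // n x _ _.
  by rewrite addr0.
apply: (unif_close_eq _ _ (unif_closeD
  (unif_closeM IHp cue (unif_boundedM bf bdpv) bv)
  (unif_closeM (unif_close_horner p cuv bv) cef bpv bf))) => n x n1 _.
  rewrite !hornerMXaddC; field.
  by rewrite pnatr_eq0 -lt0n ltnW.
by rewrite derivD derivM derivC derivX addr0 mulr1 hornerD hornerM hornerX; ring.
Qed.

End UniformApproximation.

(** * The drift polynomial and the numbers of stubborn agents *)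

Lemma majority_polyE (R : realType) (k : nat) (x : R) :
  (majority_poly R k).[x] =
  \sum_(k.+1 <= j < (2 * k).+1) 'C(2 * k, j)%:R * (x ^+ j * (1 - x) ^+ (2 * k - j)).
Proof.
rewrite /majority_poly horner_sum; apply: eq_bigr => j _.
by rewrite hornerZ hornerM hornerXn horner_exp hornerD hornerN hornerC hornerX.
Qed.

Lemma majority_poly_ge0 (R : realType) (k : nat) (x : R) : 0 <= x <= 1 ->
  0 <= (majority_poly R k).[x].
Proof.
move=> /andP[x0 x1]; rewrite majority_polyE sumr_ge0// => j _.
by rewrite mulr_ge0// mulr_ge0// exprn_ge0// subr_ge0.
Qed.

Lemma majority_poly_gt0 (R : realType) (k : nat) (x : R) : (0 < k)%N ->
  0 < x <= 1 -> 0 < (majority_poly R k).[x].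
Proof.
move=> k0 /andP[x0 x1]; rewrite majority_polyE big_nat_recr/=; last first.
  by rewrite mul2n -addnn -addn1 leq_add2l.
rewrite binn mul1r subnn expr0 mulr1 ltr_wpDl ?exprn_gt0// sumr_ge0// => j _.
by rewrite mulr_ge0// mulr_ge0// exprn_ge0 ?subr_ge0// ltW.
Qed.

Lemma drift_polyE (R : realType) (k : nat) (g0 g1 x : R) :
  (drift_poly k g0 g1).[x] =
  (1 - x - g0) * (majority_poly R k).[x] -
  (x - g1) * (majority_poly R k).[1 - x].
Proof.
rewrite /drift_poly !(hornerD, hornerN, hornerM, hornerC, hornerX, horner_comp).
by congr (_ * _ - _); ring.
Qed.

(** The root r being simple and unique, the cofactor h has no root in
    [g1, 1 - g0]; it is positive at g1, hence everywhere there. *)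
Lemma drift_poly_factor (R : realType) (k : nat) (g0 g1 r : R) : (0 < k)%N ->
  in_Gamma g0 g1 -> unique_simple_root k g0 g1 r ->
  exists (h : {poly R}) (a : R), [/\ 0 < a,
    drift_poly k g0 g1 = (r%:P - 'X) * h &
    forall x, g1 <= x <= 1 - g0 -> a <= h.[x]].
Proof.
move=> k0 [/andP[g00 g01] /andP[g10 g11] /andP[_ g0g1]] [rS r0 mup1 uniq].
have /factor_theorem [q qE] := r0.
have driftE : drift_poly k g0 g1 = (r%:P - 'X) * (- q).
  by rewrite mulrN -mulNr opprB mulrC.
have drift_g1 : 0 < (drift_poly k g0 g1).[g1].
  rewrite drift_polyE subrr mul0r subr0 mulr_gt0 ?majority_poly_gt0 ?g10 ?ltW//.
  lra.
have drift_neq0 : drift_poly k g0 g1 != 0.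
  by apply: contraTneq drift_g1 => ->; rewrite horner0 ltxx.
have qr : ~~ root q r.
  apply/negP => /factor_theorem [q' q'E].
  have : (2 <= mup r (drift_poly k g0 g1))%N.
    by rewrite mup_geq// qE q'E -mulrA -expr2 dvdp_mull.
  by rewrite mup1.
move: (rS); rewrite in_itv/= => /andP[g1r rg0].
have hE x : (drift_poly k g0 g1).[x] = (r - x) * (- q).[x].
  by rewrite driftE hornerM !hornerE.
have hS x : g1 <= x <= 1 - g0 -> ~~ root q x.
  move=> xS; apply/negP => qx; have xr : x = r.
    by apply: uniq; rewrite ?in_itv//= driftE rootM rootN qx orbT.
  by move: qr; rewrite -xr qx.
have hg1 : 0 < (- q).[g1].
  move: drift_g1; rewrite hE; case: (ltgtP g1 r) => [rg|rg|->].
  - by rewrite pmulr_rgt0// subr_gt0.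
  - by move: g1r; rewrite leNgt rg.
  - by rewrite subrr mul0r ltxx.
have hpos x : g1 <= x <= 1 - g0 -> 0 < (- q).[x].
  move=> /andP[g1x xg0]; rewrite ltNge; apply/negP => hx.
  have [|z /andP[g1z zx]] := @poly_ivt R q g1 x g1x.
    by rewrite -oppr_ge0 -hornerN (ltW hg1)/= -oppr_le0 -hornerN.
  by apply/negP/hS; rewrite g1z (le_trans zx).
have [c cS cmin] := @EVT_min R (fun x => (- q).[x]) g1 (1 - g0) (le_trans g1r rg0)
  (continuous_subspaceT (fun x => @continuous_horner _ _ _)).
exists (- q), (- q).[c]; split => //.
by apply: hpos; move: cS; rewrite in_itv.
Qed.

Lemma near_div_nat_le (R : realType) (C e : R) : 0 < e ->
  \forall n \near \oo, C / n%:R <= e.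
Proof.
move=> e0; near=> n.
have n0 : (0 : R) < n%:R by rewrite ltr0n; near: n; exists 1%N.
rewrite ler_pdivrMr// -ler_pdivrMl//.
near: n; exact: nbhs_infty_ger.
Unshelve. all: by end_near. Qed.

Section Rates.
Variables (R : realType) (g0 g1 : R).
Hypothesis (gamma : in_Gamma g0 g1).

Lemma stubborn_bounds (g : R) n : 0 < g -> n%:R * g <= (stubborn g n)%:R < n%:R * g + 1.
Proof.
move=> g0'; have ng : 0 <= n%:R * g by rewrite mulr_ge0// ltW.
rewrite /stubborn natr_absz ger0_norm; last by rewrite ceil_ge0 (lt_le_trans _ ng)// oppr_lt0.
by have := ceil_itv (n%:R * g); rewrite intrB ltrBlDr => /andP[-> ->].
Qed.

Lemma stubborn_gt0 (g : R) n : 0 < g -> (0 < n)%N -> (0 < stubborn g n)%N.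
Proof.
move=> g0' n0; have /andP[+ _] := stubborn_bounds n g0'.
by rewrite -(ltr0n R); apply: lt_le_trans; rewrite mulr_gt0// ltr0n.
Qed.

Lemma near_stubborn_le : \forall n \near \oo, (stubborn g0 n + stubborn g1 n <= n)%N.
Proof.
have [/andP[g00 _] /andP[g10 _] /andP[_ sum1]] := gamma.
have e0 : 0 < 1 - (g0 + g1) by rewrite subr_gt0.
near=> n; rewrite -(ler_nat R) natrD.
have /andP[_ b0] := stubborn_bounds n g00; have /andP[_ b1] := stubborn_bounds n g10.
have n0 : (0 : R) < n%:R by rewrite ltr0n; near: n; exists 1%N.
have : 2 / n%:R <= 1 - (g0 + g1) by near: n; exact: near_div_nat_le.
rewrite ler_pdivrMr//; lra.
Unshelve. all: by end_near. Qed.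

End Rates.

(** * Asymptotics of the rates *)

(** Closure of [unif_bounded] and [unif_close] under the ring operations and
    polynomials. Constants come first, so that they are not decomposed. *)
Ltac unif_bounded_tac :=
  repeat first [ assumption | simple apply unif_boundedC
    | simple apply unif_bounded_horner | simple apply unif_boundedM
    | simple apply unif_boundedD | simple apply unif_boundedN ].

Ltac unif_close_tac :=
  repeat first [ assumption | simple apply unif_close_refl
    | simple apply unif_close_horner | simple apply unif_closeM
    | simple apply unif_closeD | simple apply unif_closeN ]; unif_bounded_tac.

Section RateAsymptotics.
Variables (R : realType) (k : nat) (g0 g1 : R).
Hypothesis (gamma : in_Gamma g0 g1).

Local Notation P := (majority_poly R k).
Local Notation S := [set x : R | g1 <= x <= 1 - g0].

(** The jump rates divided by n. *)
Definition scaled_up (n : nat) (x : R) : R :=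
  (1 - x - (stubborn g0 n)%:R / n%:R) * P.[bfactor R n * x].

Definition scaled_down (n : nat) (x : R) : R :=
  (x - (stubborn g1 n)%:R / n%:R) * P.[bfactor R n * (1 - x)].

Lemma up_rateE n x : up_rate k g0 n x = n%:R * scaled_up n x.
Proof. by rewrite /up_rate mulrA. Qed.

Lemma down_rateE n x : down_rate k g1 n x = n%:R * scaled_down n x.
Proof. by rewrite /down_rate mulrA. Qed.

Lemma unif_bounded_id : unif_bounded S (fun _ x => x).
Proof.
have [/andP[g00 g01] /andP[g10 g11] _] := gamma.
by exists 1 => n x _ /andP[x0 x1]; rewrite ger0_norm; lra.
Qed.
Let bx := unif_bounded_id.

Lemma unif_close_bfactor : unif_close S (fun n _ => bfactor R n) (fun _ _ => 1).
Proof.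
exists 2 => n x n1 _; have n2 : (2 : R) <= n%:R by rewrite ler_nat.
rewrite /bfactor (_ : _ - 1 = (n%:R - 1)^-1); last by field; lra.
rewrite ger0_norm ?invr_ge0; last lra.
rewrite ler_pdivlMr; last lra.
by rewrite mulrC ler_pdivrMr; lra.
Qed.
Let cb := unif_close_bfactor.

Lemma unif_close_stubborn (g : R) : 0 < g ->
  unif_close S (fun n _ => (stubborn g n)%:R / n%:R) (fun _ _ => g).
Proof.
move=> gpos; exists 1 => n x n1 _; have n0 : (0 : R) < n%:R by rewrite ltr0n ltnW.
have /andP[b0 b1] := stubborn_bounds n gpos.
rewrite (_ : _ - g = ((stubborn g n)%:R - n%:R * g) / n%:R); last by field; lra.
rewrite normrM [X in _ * X]ger0_norm ?invr_ge0 ?ler0n//.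
by rewrite ler_wpM2r ?invr_ge0 ?ler0n// ger0_norm; lra.
Qed.

Let g0_gt0 : 0 < g0. Proof. by case: gamma => /andP[]. Qed.
Let g1_gt0 : 0 < g1. Proof. by case: gamma => _ /andP[]. Qed.
Let cs0 := unif_close_stubborn g0_gt0.
Let cs1 := unif_close_stubborn g1_gt0.

Let cbx : unif_close S (fun n x => bfactor R n * x) (fun _ x => x).
Proof.
apply: (@unif_close_eq _ _ _ _ (fun n x => bfactor R n * x) (fun _ x => 1 * x)) => //.
  by move=> n x _ _; rewrite mul1r.
unif_close_tac.
Qed.

Let cb1x : unif_close S (fun n x => bfactor R n * (1 - x)) (fun _ x => 1 - x).
Proof.
apply: (@unif_close_eq _ _ _ _ (fun n x => bfactor R n * (1 - x))
  (fun _ x => 1 * (1 - x))) => //.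
  by move=> n x _ _; rewrite mul1r.
unif_close_tac.
Qed.

Lemma unif_close_scaled_up :
  unif_close S scaled_up (fun _ x => (1 - x - g0) * P.[x]).
Proof. rewrite /scaled_up; unif_close_tac. Qed.

Lemma unif_close_scaled_down :
  unif_close S scaled_down (fun _ x => (x - g1) * P.[1 - x]).
Proof. rewrite /scaled_down; unif_close_tac. Qed.

Lemma unif_close_shift u e c : unif_close S u (fun _ x => c x) ->
  unif_bounded S e ->
  unif_close S (fun n x => u n x + e n x / n%:R) (fun _ x => c x).
Proof.
move=> cu be; apply: (unif_close_eq _ _ (unif_closeD cu (unif_close_invn be))) => //.
by move=> n x _ _; rewrite addr0.
Qed.

Let bb : unif_bounded S (fun n _ => bfactor R n).
Proof. exact: unif_close_bounded cb (unif_boundedC _ 1). Qed.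

Lemma unif_close_scaled_up_diff :
  unif_close S (fun n x => n%:R * (scaled_up n (x + n%:R^-1) - scaled_up n x))
    (fun _ x => - P.[x] + (1 - x - g0) * P^`().[x]).
Proof.
have b1 : unif_bounded S (fun _ _ => 1 : R) by exact: unif_boundedC.
have dP := unif_close_horner_diff P cbx bx cb b1.
have sh := unif_close_shift cbx bb.
apply: (@unif_close_eq _ _ _ _
  (fun n x => - P.[bfactor R n * x + bfactor R n / n%:R] +
     (1 - x - (stubborn g0 n)%:R / n%:R) *
     (n%:R * (P.[bfactor R n * x + bfactor R n / n%:R] - P.[bfactor R n * x])))
  (fun _ x => - P.[x] + (1 - x - g0) * (1 * P^`().[x]))).
- move=> n x n1 _; rewrite /scaled_up.
  have -> : bfactor R n * (x + n%:R^-1) = bfactor R n * x + bfactor R n / n%:R.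
    by rewrite mulrDr.
  by field; rewrite pnatr_eq0 -lt0n ltnW.
- by move=> n x _ _; rewrite mul1r.
unif_close_tac.
Qed.

Lemma unif_close_scaled_down_diff :
  unif_close S (fun n x => n%:R * (scaled_down n (x + n%:R^-1) - scaled_down n x))
    (fun _ x => P.[1 - x] - (x - g1) * P^`().[1 - x]).
Proof.
have b1 : unif_bounded S (fun _ _ => - 1 : R) by exact: unif_boundedC.
have b1x : unif_bounded S (fun _ x => 1 - x) by unif_bounded_tac.
have bbN : unif_bounded S (fun n _ => - bfactor R n) by unif_bounded_tac.
have dP := unif_close_horner_diff P cb1x b1x (unif_closeN cb) b1.
have sh := unif_close_shift cb1x bbN.
apply: (@unif_close_eq _ _ _ _
  (fun n x => P.[bfactor R n * (1 - x) + - bfactor R n / n%:R] +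
     (x - (stubborn g1 n)%:R / n%:R) *
     (n%:R * (P.[bfactor R n * (1 - x) + - bfactor R n / n%:R] -
        P.[bfactor R n * (1 - x)])))
  (fun _ x => P.[1 - x] + (x - g1) * (- 1 * P^`().[1 - x]))).
- move=> n x n1 _; rewrite /scaled_down.
  have -> : bfactor R n * (1 - (x + n%:R^-1)) =
    bfactor R n * (1 - x) + - bfactor R n / n%:R by ring.
  by field; rewrite pnatr_eq0 -lt0n ltnW.
- by move=> n x _ _; ring.
unif_close_tac.
Qed.

Variables (r a : R) (h : {poly R}).
Hypotheses (a_gt0 : 0 < a) (driftE : drift_poly k g0 g1 = (r%:P - 'X) * h).
Hypothesis h_ge : forall x, g1 <= x <= 1 - g0 -> a <= h.[x].

Lemma drift_at x :
  (1 - x - g0) * P.[x] - (x - g1) * P.[1 - x] = (r - x) * h.[x].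
Proof. by rewrite -drift_polyE driftE hornerM !hornerE. Qed.

Lemma deriv_drift_at x :
  - P.[x] + (1 - x - g0) * P^`().[x] - (P.[1 - x] - (x - g1) * P^`().[1 - x]) =
  - h.[x] + (r - x) * h^`().[x].
Proof.
have := congr1 (fun p : {poly R} => p^`().[x]) driftE.
rewrite /drift_poly !(derivD, derivN, derivM, deriv_comp, derivC, derivX).
rewrite !(hornerD, hornerN, hornerM, hornerC, hornerX, horner_comp).
move: P.[x] P^`().[x] P.[1 - x] P^`().[1 - x] h.[x] h^`().[x] => p p' q q' y y' H.
by lra.
Qed.

(** The supersolution condition for the weight 1/h at the edge from x to
    x + 1/n, without the right-hand side, multiplied by
    h(x - 1/n) h(x) h(x + 1/n) to clear denominators. *)
Definition weight_defect (n : nat) (x : R) : R :=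
  n%:R * (scaled_up n (x + n%:R^-1) * (h.[x - n%:R^-1] * h.[x])
   - (scaled_down n (x + n%:R^-1) + scaled_up n x) *
       (h.[x - n%:R^-1] * h.[x + n%:R^-1])
   + scaled_down n x * (h.[x] * h.[x + n%:R^-1])).

Let b1 : unif_bounded S (fun _ _ => 1 : R).
Proof. exact: unif_boundedC. Qed.

Let bN1 : unif_bounded S (fun _ _ => - 1 : R).
Proof. exact: unif_boundedC. Qed.

Let cxp : unif_close S (fun n x => x + n%:R^-1) (fun _ x => x).
Proof.
apply: (unif_close_eq _ _ (unif_close_shift (unif_close_refl S (fun _ x => x)) b1)) => //.
by move=> n x _ _; rewrite mul1r.
Qed.

Let cxm : unif_close S (fun n x => x - n%:R^-1) (fun _ x => x).
Proof.
apply: (unif_close_eq _ _ (unif_close_shift (unif_close_refl S (fun _ x => x)) bN1)) => //.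
by move=> n x _ _; rewrite mulN1r.
Qed.

(** The terms of order n cancel exactly. What remains tends to
    h^3 (Delta / h)' = - h^3. *)
Lemma unif_close_weight_defect :
  unif_close S weight_defect (fun _ x => - h.[x] ^+ 3).
Proof.
have cx := unif_close_refl S (fun _ x => x).
have dhp := unif_close_horner_diff h cx bx (unif_close_refl S (fun _ _ => 1)) b1.
have dhm := unif_close_horner_diff h cx bx (unif_close_refl S (fun _ _ => - 1)) bN1.
have cA := unif_close_scaled_up; have cB := unif_close_scaled_down.
have cA' := unif_close_scaled_up_diff; have cB' := unif_close_scaled_down_diff.
apply: (@unif_close_eq _ _ _ _
  (fun n x => - scaled_up n x * h.[x - n%:R^-1] *
      (n%:R * (h.[x + 1 / n%:R] - h.[x])) +
    - scaled_down n x * h.[x + n%:R^-1] *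
      (n%:R * (h.[x + - 1 / n%:R] - h.[x])) +
    (n%:R * (scaled_up n (x + n%:R^-1) - scaled_up n x)) *
      (h.[x - n%:R^-1] * h.[x]) +
    - (n%:R * (scaled_down n (x + n%:R^-1) - scaled_down n x)) *
      (h.[x - n%:R^-1] * h.[x + n%:R^-1]))
  (fun _ x => - ((1 - x - g0) * P.[x]) * h.[x] * (1 * h^`().[x]) +
    - ((x - g1) * P.[1 - x]) * h.[x] * (- 1 * h^`().[x]) +
    (- P.[x] + (1 - x - g0) * P^`().[x]) * (h.[x] * h.[x]) +
    - (P.[1 - x] - (x - g1) * P^`().[1 - x]) * (h.[x] * h.[x]))).
- by move=> n x _ _; rewrite /weight_defect mulN1r mul1r; ring.
- move=> n x _ _.
  have -> : - h.[x] ^+ 3 =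
    - ((r - x) * h.[x]) * h.[x] * h^`().[x] +
    (- h.[x] + (r - x) * h^`().[x]) * h.[x] ^+ 2 by ring.
  by rewrite -drift_at -deriv_drift_at; ring.
unif_close_tac.
Qed.

(** The generator applied to the squared distance to r, at x. *)
Definition square_drift (n : nat) (x : R) : R :=
  n%:R * scaled_up n x * ((x + n%:R^-1 - r) ^+ 2 - (x - r) ^+ 2) +
  n%:R * scaled_down n x * ((x - n%:R^-1 - r) ^+ 2 - (x - r) ^+ 2).

Lemma unif_close_square_drift :
  unif_close S square_drift (fun _ x => - 2 * h.[x] * (x - r) ^+ 2).
Proof.
have cA := unif_close_scaled_up; have cB := unif_close_scaled_down.
have c0 : unif_close S (fun n _ => 1 / n%:R) (fun _ _ => 0 : R).
  exact: unif_close_invn b1.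
apply: (@unif_close_eq _ _ _ _
  (fun n x => scaled_up n x * (2 * (x - r) + 1 / n%:R) +
    scaled_down n x * (- 2 * (x - r) + 1 / n%:R))
  (fun _ x => (1 - x - g0) * P.[x] * (2 * (x - r) + 0) +
    (x - g1) * P.[1 - x] * (- 2 * (x - r) + 0))).
- move=> n x n1 _; rewrite /square_drift; field.
  by rewrite pnatr_eq0 -lt0n ltnW.
- move=> n x _ _.
  have -> : - 2 * h.[x] * (x - r) ^+ 2 = 2 * ((r - x) * h.[x]) * (x - r) by ring.
  by rewrite -drift_at; ring.
unif_close_tac.
Qed.

(** The weight 1/h is a strict supersolution of the linearized dynamics, with a
    rate that does not depend on n. *)
Lemma near_weight_supersolution : exists kappa H : R,
  [/\ 0 < kappa, forall x, S x -> h.[x] <= H &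
   \forall n \near \oo, forall x, S x -> S (x + n%:R^-1) ->
     0 < h.[x - n%:R^-1] /\
     n%:R * scaled_up n (x + n%:R^-1) / h.[x + n%:R^-1]
     - (n%:R * scaled_down n (x + n%:R^-1) + n%:R * scaled_up n x) / h.[x]
     + n%:R * scaled_down n x / h.[x - n%:R^-1] <= - kappa / h.[x]].
Proof.
have [H HH] := unif_bounded_horner h bx.
have [C HC] := unif_close_weight_defect.
have [D HD] := unif_close_horner h cxm bx.
have [H' HH'] := unif_bounded_horner h (unif_close_bounded cxm bx).
pose K := `|H| * `|H'| + 1.
have K0 : 0 < K by rewrite ltr_pwDr// mulr_ge0.
exists (a ^+ 3 / 2 / K), H; split.
- by rewrite !divr_gt0// exprn_gt0.
- by move=> x Sx; rewrite (le_trans (ler_norm _))// (HH 2%N).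
near=> n => x Sx Sx'.
have n1 : (1 < n)%N by near: n; exists 2%N.
have hx := h_ge Sx; have hx' := h_ge Sx'.
(* When x = g1 the point x - 1/n lies outside the interval, so the bound on h
   is recovered from the closeness of x - 1/n to x. *)
have hm : a / 2 <= h.[x - n%:R^-1].
  have : D / n%:R <= a / 2 by near: n; apply: near_div_nat_le; rewrite divr_gt0.
  have := HD n x n1 Sx; rewrite ler_distl => /andP[]; lra.
have hm0 : 0 < h.[x - n%:R^-1] by apply: lt_le_trans hm; rewrite divr_gt0.
have hx0 : 0 < h.[x] by exact: lt_le_trans hx.
have hx'0 : 0 < h.[x + n%:R^-1] by exact: lt_le_trans hx'.
split=> //.
have defect : weight_defect n x <= - (a ^+ 3 / 2).
  have : C / n%:R <= a ^+ 3 / 2.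
    by near: n; apply: near_div_nat_le; rewrite divr_gt0// exprn_gt0.
  have : a ^+ 3 <= h.[x] ^+ 3 by rewrite lerXn2r// nnegrE ltW.
  have := HC n x n1 Sx; rewrite ler_distl => /andP[]; lra.
have prod_le : h.[x - n%:R^-1] * h.[x + n%:R^-1] <= K.
  have h1 : h.[x - n%:R^-1] <= `|H'|.
    by rewrite (le_trans (ler_norm _))// (le_trans (HH' n x n1 Sx))// ler_norm.
  have h2 : h.[x + n%:R^-1] <= `|H|.
    by rewrite (le_trans (ler_norm _))// (le_trans (HH n _ n1 Sx'))// ler_norm.
  rewrite mulrC (@le_trans _ _ (`|H| * `|H'|)) ?ler_pM// ?ltW// /K.
  by rewrite ltrDl.
have pos : 0 < h.[x - n%:R^-1] * h.[x] * h.[x + n%:R^-1] by rewrite !mulr_gt0.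
rewrite -(ler_pM2r pos).
apply: (@le_trans _ _ (weight_defect n x)).
  rewrite le_eqVlt; apply/orP; left; apply/eqP; rewrite /weight_defect.
  by field; rewrite !gt_eqF.
apply: (le_trans defect).
have -> : - (a ^+ 3 / 2 / K) / h.[x] *
    (h.[x - n%:R^-1] * h.[x] * h.[x + n%:R^-1]) =
    - (a ^+ 3 / 2 / K * (h.[x - n%:R^-1] * h.[x + n%:R^-1])).
  by field; rewrite !gt_eqF.
rewrite lerN2 -[leRHS](@divfK _ K) ?gt_eqF// ler_wpM2l//.
by rewrite !divr_ge0// ?exprn_ge0// ltW.
Unshelve. all: by end_near. Qed.

(** Foster-Lyapunov inequality for the squared distance to the root. *)
Lemma square_drift_le : exists C : R, forall n x, (1 < n)%N -> S x ->
  square_drift n x <= - (2 * a) * (x - r) ^+ 2 + C / n%:R.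
Proof.
have [C HC] := unif_close_square_drift; exists C => n x n1 Sx.
have := HC n x n1 Sx; rewrite ler_distl => /andP[_ H].
apply: (le_trans H); rewrite lerD2r !mulNr lerN2.
by rewrite ler_wpM2r ?sqr_ge0// ler_wpM2l// h_ge.
Qed.

End RateAsymptotics.

(** * The chain of the model *)

Lemma is_bigO_near (R : realType) (f : nat -> \bar R) (g : nat -> R) (C : R) :
  (\forall n \near \oo, 0 < g n) ->
  (\forall n \near \oo, (f n <= (C * g n)%:E)%E) -> is_bigO f g.
Proof.
move=> [N1 _ HN1] [N2 _ HN2].
rewrite /is_bigO limn_esup_lim; apply: (@le_lt_trans _ _ C%:E); last exact: ltry.
apply: lime_le; first exact: is_cvg_esups.
exists (maxn N1 N2) => // n /=; rewrite geq_max => /andP[N1n N2n].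
apply: ge_ereal_sup => _ [l /= nl <-].
have gl : 0 < g l by apply: HN1; exact: leq_trans nl.
have fl := HN2 l (leq_trans N2n nl).
rewrite -[C](mulfK (lt0r_neq0 gl)) EFinM lee_wpmul2r//.
by rewrite lee_fin invr_ge0 ltW.
Qed.

Section ChoicesChain.
Variables (R : realType) (k : nat) (g0 g1 : R).
Hypotheses (gamma : in_Gamma g0 g1).
Variable n : nat.
Hypotheses (n1 : (1 < n)%N) (stub : (stubborn g0 n + stubborn g1 n <= n)%N).

Local Notation m := (top g0 g1 n).

(** The state with index i, and its birth and death rates, for any i : nat. *)
Definition state_pos (i : nat) : R := (stubborn g1 n + i)%:R / n%:R.
Definition chain_up (i : nat) : R := up_rate k g0 n (state_pos i).
Definition chain_down (i : nat) : R := down_rate k g1 n (state_pos i).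

Let g0_gt0 : 0 < g0. Proof. by case: gamma => /andP[]. Qed.
Let g1_gt0 : 0 < g1. Proof. by case: gamma => _ /andP[]. Qed.
Let n_gt1 : 1 < n%:R :> R. Proof. by rewrite ltr1n. Qed.
Let n_gt0 : 0 < n%:R :> R. Proof. exact: lt_trans n_gt1. Qed.

Let bfactor_ge0 : 0 <= bfactor R n.
Proof. by rewrite divr_ge0 ?ler0n// subr_ge0 ltW. Qed.

Lemma choices_generatorE :
  choices_generator k g0 g1 n = bd_generator m chain_up chain_down.
Proof. by []. Qed.

Lemma state_posS i : state_pos i.+1 = state_pos i + n%:R^-1.
Proof. by rewrite /state_pos addnS -natr1 mulrDl mul1r. Qed.

Lemma state_pos_top : state_pos m = 1 - (stubborn g0 n)%:R / n%:R.
Proof.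
rewrite /state_pos /top subnDA subnKC; last by rewrite leq_subRL ?(leq_trans (leq_addr _ _) stub).
rewrite natrB ?(leq_trans (leq_addr _ _) stub)// mulrBl divff ?gt_eqF//.
Qed.

Lemma state_pos_le i j : (i <= j)%N -> state_pos i <= state_pos j.
Proof.
by move=> ij; rewrite /state_pos ler_wpM2r ?invr_ge0 ?ler0n// ler_nat leq_add2l.
Qed.

Lemma state_pos_itv i : (i <= m)%N -> g1 <= state_pos i <= 1 - g0.
Proof.
move=> im; apply/andP; split.
  apply: le_trans (state_pos_le (leq0n i)).
  rewrite /state_pos addn0 ler_pdivlMr// mulrC.
  by have /andP[] := stubborn_bounds n g1_gt0.
apply: le_trans (state_pos_le im) _; rewrite state_pos_top lerD2l lerN2.
rewrite ler_pdivlMr// mulrC.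
by have /andP[] := stubborn_bounds n g0_gt0.
Qed.

Lemma chain_down0 : chain_down 0 = 0.
Proof. by rewrite /chain_down /down_rate /state_pos addn0 subrr mulr0 mul0r. Qed.

Lemma chain_up_top : chain_up m = 0.
Proof.
by rewrite /chain_up /up_rate state_pos_top [X in _ * X * _](_ : _ = 0) ?mulr0 ?mul0r//; ring.
Qed.

(** The argument of the majority polynomial is at most 1 because at least one
    agent stubbornly holds opinion 0; opinion 1 plays this role for the death
    rates. *)
Lemma chain_up_ge0 i : (i <= m)%N -> 0 <= chain_up i.
Proof.
move=> im; rewrite /chain_up /up_rate.
have itop := state_pos_le im; rewrite state_pos_top in itop.
have i0 : 0 <= state_pos i by rewrite divr_ge0.
have s0 : (n%:R^-1 : R) <= (stubborn g0 n)%:R / n%:R.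
  by rewrite ler_peMl ?invr_ge0 ?ler0n// ler1n stubborn_gt0// ltnW.
apply: mulr_ge0.
  by apply: mulr_ge0; [exact: ler0n | rewrite -addrA -opprD subr_ge0 -lerBrDr].
apply: majority_poly_ge0; rewrite /bfactor; apply/andP; split.
  by apply: mulr_ge0 => //; exact: bfactor_ge0.
rewrite mulrAC ler_pdivrMr ?subr_gt0//.
rewrite mul1r; apply: (@le_trans _ _ (n%:R * (1 - n%:R^-1))).
  by rewrite ler_wpM2l ?ler0n//; lra.
by rewrite mulrBr mulr1 divff ?gt_eqF.
Qed.

Lemma chain_down_ge0 i : (i <= m)%N -> 0 <= chain_down i.
Proof.
move=> im; rewrite /chain_down /down_rate.
have /andP[_ iS] := state_pos_itv im.
have i0 := state_pos_le (leq0n i); rewrite {1}/state_pos addn0 in i0.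
have s1 : (n%:R^-1 : R) <= (stubborn g1 n)%:R / n%:R.
  by rewrite ler_peMl ?invr_ge0 ?ler0n// ler1n stubborn_gt0// ltnW.
apply: mulr_ge0.
  by apply: mulr_ge0; [exact: ler0n | rewrite subr_ge0].
apply: majority_poly_ge0; rewrite /bfactor; apply/andP; split.
  apply: mulr_ge0; first exact: bfactor_ge0.
  by rewrite subr_ge0 (le_trans iS)// gerBl ltW.
rewrite mulrAC ler_pdivrMr ?subr_gt0//.
rewrite mul1r; apply: (@le_trans _ _ (n%:R * (1 - n%:R^-1))).
  by rewrite ler_wpM2l ?ler0n//; lra.
by rewrite mulrBr mulr1 divff ?gt_eqF.
Qed.

Lemma bd_op_square (r : R) i :
  bd_op chain_up chain_down (fun i => (state_pos i - r) ^+ 2) i =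
  square_drift k g0 g1 r n (state_pos i).
Proof.
rewrite /bd_op /square_drift -up_rateE -down_rateE -/(chain_up i) -/(chain_down i).
rewrite state_posS; case: i => [|i]; first by rewrite chain_down0 !mul0r.
have -> : state_pos i.+1 - n%:R^-1 = state_pos i by rewrite state_posS addrK.
by [].
Qed.

End ChoicesChain.

(** * Bounds uniform in the number of agents *)

Section UniformEstimates.
Variables (R : realType) (k : nat) (g0 g1 : R).
Hypotheses (gamma : in_Gamma g0 g1).
Variables (r a : R) (h : {poly R}).
Hypotheses (a_gt0 : 0 < a) (driftE : drift_poly k g0 g1 = (r%:P - 'X) * h).
Hypothesis h_ge : forall x, g1 <= x <= 1 - g0 -> a <= h.[x].
Hypothesis r_itv : g1 <= r <= 1 - g0.

Let g0_lt1 : 0 < g0 < 1. Proof. by case: gamma. Qed.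
Let g1_lt1 : 0 < g1 < 1. Proof. by case: gamma. Qed.

(** At some time s independent of n and of the starting point, the chain is
    outside the ball around r with probability at most 1/2. *)
Lemma near_far_probability_half (delta : R) : 0 < delta -> exists2 s : R, 0 < s &
  \forall n \near \oo, forall y : 'I_(top g0 g1 n).+1,
    (forall l, 0 <= transition (choices_generator k g0 g1 n) s y l) ->
    \sum_(l in [set l : 'I_(top g0 g1 n).+1 |
        ~~ `[< `]r - delta, r + delta[%classic (proportion l) >]]%SET)
      transition (choices_generator k g0 g1 n) s y l <= 1 / 2.
Proof.
move=> d0; have [C HC] := square_drift_le gamma driftE h_ge.
have d2 : 0 < delta ^+ 2 by rewrite exprn_gt0.
(* exp(- 2 a s) = exp(- 4 / delta^2) <= delta^2 / 4. *)
pose s := 2 / (a * delta ^+ 2).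
have s0 : 0 < s by rewrite divr_gt0// mulr_gt0.
exists s => //; near=> n => y P0.
have n1 : (1 < n)%N by near: n; exists 2%N.
have stub : (stubborn g0 n + stubborn g1 n <= n)%N.
  by near: n; exact: near_stubborn_le.
pose V i := (state_pos g1 n i - r) ^+ 2 : R.
have c0 : 0 < 2 * a by rewrite mulr_gt0.
have small : `|C| / n%:R <= a * delta ^+ 2 / 2.
  by near: n; apply: near_div_nat_le; rewrite divr_gt0// mulr_gt0.
have drift i : (i <= top g0 g1 n)%N ->
    bd_op (chain_up k g0 g1 n) (chain_down k g1 n) V i <=
    - (2 * a) * V i + `|C| / n%:R.
  move=> im; rewrite /V bd_op_square//.
  apply: le_trans (HC n _ n1 (state_pos_itv gamma n1 stub im)) _.
  by rewrite lerD2l ler_wpM2r ?invr_ge0// ler_norm.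
have Vy : V y <= 1.
  have im : (y <= top g0 g1 n)%N by rewrite -ltnS.
  have := state_pos_itv gamma n1 stub im => /andP[b1 b2].
  rewrite /V -(real_normK (num_real _)) exprn_ile1// ler_norml.
  move: r_itv g0_lt1 g1_lt1 => /andP[? ?] /andP[? ?] /andP[? ?].
  by apply/andP; split; lra.
have semi := @bd_semigroup_drift _ _ _ _ (chain_down0 k g1 n)
  (chain_up_top k n1 stub) (chain_up_ge0 k gamma n1 stub)
  (chain_down_ge0 k gamma n1 stub) (2 * a) (`|C| / n%:R) s V y (ltW s0) c0 drift.
have decay : expR (- (2 * a) * s) <= delta ^+ 2 / 4.
  have -> : - (2 * a) * s = - (4 / delta ^+ 2).
    by rewrite /s; field; rewrite !gt_eqF.
  rewrite expRN -[leRHS]invf_div lef_pV2 ?posrE ?expR_gt0 ?divr_gt0//.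
  by apply: le_trans (expR_ge1Dx _); rewrite lerDr.
(* Chebyshev's inequality: outside the ball, V is at least delta^2. *)
rewrite -(ler_pM2r d2) mulr_suml.
apply: (@le_trans _ _ (bd_semigroup (chain_up k g0 g1 n) (chain_down k g1 n) s V y)).
  rewrite /bd_semigroup -choices_generatorE [leRHS](bigID (mem
    [set l : 'I_(top g0 g1 n).+1 |
        ~~ `[< `]r - delta, r + delta[%classic (proportion l) >]]%SET))/=.
  rewrite -[leLHS]addr0 lerD//; last first.
    by apply: sumr_ge0 => l _; rewrite mulr_ge0 ?sqr_ge0.
  apply: ler_sum => l; rewrite inE => /asboolP far; rewrite ler_wpM2l//.
  rewrite /V -[leRHS](real_normK (num_real _)) lerXn2r ?nnegrE ?(ltW d0)// leNgt.
  apply/negP; rewrite ltr_norml => /andP[b1 b2]; apply: far.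
  rewrite /= in_itv/= -[proportion l]/(state_pos g1 n l); apply/andP; split; lra.
apply: (le_trans semi).
set e := expR _ in decay *; set b := `|C| / n%:R in small *.
have b0 : 0 <= b by rewrite /b divr_ge0.
have bc : b / (2 * a) <= delta ^+ 2 / 4.
  rewrite ler_pdivrMr//; apply: (le_trans small).
  by rewrite le_eqVlt; apply/orP; left; apply/eqP; field.
have bc0 : 0 <= b / (2 * a) by rewrite divr_ge0// ltW.
have e0 : 0 <= e by exact: expR_ge0.
have : e * (V y - b / (2 * a)) <= e.
  by rewrite -[leRHS]mulr1 ler_wpM2l//; lra.
lra.
Unshelve. all: by end_near. Qed.

(** At a time of order ln n the laws from any two starting points are at total
    variation distance at most 1/4. *)
Lemma near_mixing_quarter : exists2 K : R, 0 < K &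
  \forall n \near \oo, forall (x y : 'I_(top g0 g1 n).+1)
      (A : {set 'I_(top g0 g1 n).+1}),
    `|\sum_(j in A) transition (choices_generator k g0 g1 n) (K * ln n%:R) x j -
      \sum_(j in A) transition (choices_generator k g0 g1 n) (K * ln n%:R) y j|
    <= 1 / 4.
Proof.
have [kappa [H [kappa0 hH supersol]]] :=
  near_weight_supersolution gamma a_gt0 driftE h_ge.
(* exp(- kappa t) = n^-2 at t = (2 / kappa) ln n. *)
exists (2 / kappa); first by rewrite divr_gt0.
have H0 : 0 < H.
  by apply: lt_le_trans a_gt0 _; apply: le_trans (hH r r_itv); exact: h_ge.
near=> n => x y A.
have n1 : (1 < n)%N by near: n; exists 2%N.
have n0 : (0 : R) < n%:R by rewrite ltr0n ltnW.
have stub : (stubborn g0 n + stubborn g1 n <= n)%N.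
  by near: n; exact: near_stubborn_le.
have sup : forall x, g1 <= x <= 1 - g0 -> g1 <= x + n%:R^-1 <= 1 - g0 ->
     0 < h.[x - n%:R^-1] /\
     n%:R * scaled_up k g0 n (x + n%:R^-1) / h.[x + n%:R^-1]
     - (n%:R * scaled_down k g1 n (x + n%:R^-1) + n%:R * scaled_up k g0 n x) / h.[x]
     + n%:R * scaled_down k g1 n x / h.[x - n%:R^-1] <= - kappa / h.[x].
  by near: n; exact: supersol.
set t := 2 / kappa * ln n%:R.
have t0 : 0 <= t by rewrite mulr_ge0 ?ln_ge0 ?ler1n ?(ltnW n1)// divr_ge0// ltW.
(* The factor H makes w at least 1, the Lipschitz constant of an indicator. *)
pose w i := H / h.[state_pos g1 n i].
pose F i : R := ((inord i : 'I_(top g0 g1 n).+1) \in A)%:R.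
have sumE (z : 'I_(top g0 g1 n).+1) :
    \sum_(j in A) transition (choices_generator k g0 g1 n) t z j =
    bd_semigroup (chain_up k g0 g1 n) (chain_down k g1 n) t F z.
  rewrite /bd_semigroup -choices_generatorE big_mkcond; apply: eq_bigr => j _.
  by rewrite /F inord_val; case: (j \in A); rewrite ?mulr1 ?mulr0.
rewrite !sumE.
have itv i : (i <= top g0 g1 n)%N -> g1 <= state_pos g1 n i <= 1 - g0.
  exact: state_pos_itv.
have hpos i : (i <= top g0 g1 n)%N -> 0 < h.[state_pos g1 n i].
  by move=> /itv /h_ge; exact: lt_le_trans.
apply: le_trans (@bd_semigroup_contract _ _ _ _ (chain_down0 k g1 n)
  (chain_up_top k n1 stub) (chain_up_ge0 k gamma n1 stub)
  (chain_down_ge0 k gamma n1 stub) kappa (H / a) w t F x y t0 _ _ _) _.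
- move=> i im; have := sup _ (itv i (ltnW im)); rewrite -state_posS => /(_ (itv _ im)) [_].
  rewrite -!up_rateE -!down_rateE -!/(chain_up k g0 g1 n _) -!/(chain_down k g1 n _).
  have -> : chain_down k g1 n i / h.[state_pos g1 n i - n%:R^-1] =
      chain_down k g1 n i / h.[state_pos g1 n i.-1].
    case: i im => [|i] im; first by rewrite chain_down0 !mul0r.
    by rewrite [state_pos g1 n i.+1]state_posS addrK.
  move=> /(ler_wpM2l (ltW H0)); rewrite /w.
  by congr (_ <= _); ring.
- move=> i im; apply: (@le_trans _ _ 1).
    by rewrite /F; do 2 case: (_ \in A); rewrite ?subrr ?subr0 ?sub0r ?normrN ?normr1 ?normr0.
  by rewrite /w ler_pdivlMr ?hpos ?(ltnW im)// mul1r; exact: (hH _ (itv _ (ltnW im))).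
- move=> i im; rewrite /w ler_wpM2l ?(ltW H0)// lef_pV2 ?posrE ?hpos ?(ltnW im)//.
  by rewrite h_ge// itv// ltnW.
have -> : expR (- kappa * t) = (n%:R ^+ 2)^-1.
  have -> : - kappa * t = - (2%:R * ln n%:R) by rewrite /t; field; rewrite gt_eqF.
  by rewrite expRN expRM_natl lnK ?posrE.
apply: (@le_trans _ _ (H / a / n%:R)); last first.
  by near: n; apply: near_div_nat_le; rewrite divr_gt0.
have -> : H / a / n%:R = (n%:R ^+ 2)^-1 * (n%:R * (H / a)).
  by field; rewrite !gt_eqF.
rewrite ler_wpM2l ?invr_ge0 ?exprn_ge0// ler_wpM2r ?divr_ge0 ?(ltW H0) ?(ltW a_gt0)//.
by rewrite ler_nat leq_subr.
Unshelve. all: by end_near. Qed.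

End UniformEstimates.

Lemma near_ln_ge1 (R : realType) : \forall n \near \oo, 1 <= ln (n%:R : R).
Proof.
near=> n; rewrite -[leLHS](expRK 1) ler_ln ?posrE ?expR_gt0//.
  by near: n; exact: nbhs_infty_ger.
by rewrite ltr0n; near: n; exists 1%N.
Unshelve. all: by end_near. Qed.

Theorem theorem6 (R : realType) (k : nat) (hk : (1 <= k)%N) (g0 g1 r : R)
  (hG : in_Gamma_sup k g0 g1)
  (hr : unique_simple_root k g0 g1 r)
  (d : nat -> measure_display)
  (T : forall n : nat, measurableType (d n))
  (X : forall n : nat, R -> T n -> 'I_(top g0 g1 n).+1)
  (Pr : forall n : nat, 'I_(top g0 g1 n).+1 -> probability (T n) R)
  (hX : forall n : nat, (stubborn g0 n + stubborn g1 n <= n)%N ->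
    markov_chain (choices_generator k g0 g1 n) (X n) (Pr n))
  (p : forall n : nat, 'rV[R]_(top g0 g1 n).+1)
  (hp : forall n : nat, (stubborn g0 n + stubborn g1 n <= n)%N ->
    stationary (choices_generator k g0 g1 n) (p n)) :
  (forall delta : R, 0 < delta ->
   forall x : (forall n : nat, 'I_(top g0 g1 n).+1),
     is_bigO
       (fun n : nat =>
          (\int[Pr n (x n)]_(w in [set: T n])
            (enter_time (fun (t : R) (v : T n) => proportion (X n t v))
               `]r - delta, r + delta[ w)%R)%E)
       (fun n : nat => ln n%:R))
  /\
  is_bigO (fun n : nat => mixing_time (X n) (Pr n) (p n))
    (fun n : nat => ln n%:R).
Proof.
have [gamma _] := hG.
have [h [a [a0 driftE h_ge]]] := drift_poly_factor hk gamma hr.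
have r_itv : g1 <= r <= 1 - g0 by case: hr; rewrite in_itv.
have ln_gt0 : \forall n \near \oo, 0 < ln (n%:R : R).
  by apply: filterS (near_ln_ge1 R) => n; exact: lt_le_trans.
split.
  move=> delta d0 x.
  have [s s0 half] := near_far_probability_half gamma a0 driftE h_ge r_itv d0.
  apply: (@is_bigO_near _ _ _ (2 * s)) => //; near=> n.
  have stub : (stubborn g0 n + stubborn g1 n <= n)%N.
    by near: n; exact: near_stubborn_le.
  have mc := hX n stub.
  apply: (@le_trans _ _ (2 * s)%:E); last first.
    rewrite lee_fin ler_peMr ?mulr_ge0 ?(ltW s0)//.
    by near: n; exact: near_ln_ge1.
  apply: (expectation_enter_time_le mc) => // y.
  have half_n : forall y : 'I_(top g0 g1 n).+1,
      (forall l, 0 <= transition (choices_generator k g0 g1 n) s y l) ->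
      \sum_(l in [set l : 'I_(top g0 g1 n).+1 |
          ~~ `[< `]r - delta, r + delta[%classic (proportion l) >]]%SET)
        transition (choices_generator k g0 g1 n) s y l <= 1 / 2.
    by near: n; exact: half.
  by apply: half_n => l; apply: (transition_ge0 mc); exact: ltW.
have [K K0 quarter] := near_mixing_quarter gamma a0 driftE h_ge r_itv.
apply: (@is_bigO_near _ _ _ K) => //; near=> n.
have stub : (stubborn g0 n + stubborn g1 n <= n)%N.
  by near: n; exact: near_stubborn_le.
have t0 : 0 <= K * ln (n%:R : R).
  by rewrite mulr_ge0 ?(ltW K0)// ltW//; near: n; exact: ln_gt0.
apply: ereal_inf_lbound; exists (K * ln n%:R) => //; split => //.
apply: (mixing_distance_le (hX n stub) t0 _ (hp n stub)) => //.
by near: n; exact: quarter.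
Unshelve. all: by end_near. Qed.
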